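(* Let $\{x^k\}$ and $\{p_k\}$ be the sequences generated by the algorithm CDP-ESQM (described in the context) applied to the problem $$(\mathrm{P})\qquad \min_{x\in X}\ \varphi_0(x)=g_0(x)-h_0(x)\quad\text{subject to}\quad \varphi_i(x)=g_i(x)-h_i(x)\le 0,\ i\in\mathcal I .$$ Then the algorithm either terminates at a stationary point of (P), or for any subsequence $\{x^{k_j}\}$ with $x^{k_j}\to\bar x$ as $j\to\infty$ the following assertions hold: (i) If $\{p_k\}$ is bounded, then $\bar x$ is a stationary point of (P). (ii) If $\{p_k\}$ is unbounded, then there exist $\bar\lambda_i\in[0,1]$, $i\in\mathcal I$, such that $\bar\lambda_i=0$ whenever $\varphi_i(\bar x)<0$, $\bar\lambda_i=1$ whenever $\varphi_i(\bar x)>0$, and $$0\in\sum_{i\in\mathcal I}\bar\lambda_i\big(\nabla g_i(\bar x)-\partial h_i(\bar x)\big)+\mathcal N_X(\bar x).$$ Moreover, if the sequence $\{x^k\}$ is bounded, then the set of its accumulation points is nonempty, closed, and connected. Finally, if the sequence $\{x^k\}$ has an isolated accumulation point $\bar x$, then the entire sequence $\{x^k\}$ converges to $\bar x$ as $k\to\infty$.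
   Context: **Standing assumptions.** $\mathcal I$ is a finite index set and $X\subset\mathbb R^n$ is nonempty, closed and convex. For $i\in\{0\}\cup\mathcal I$, $g_i:\mathbb R^n\to\mathbb R$ is continuously differentiable with locally Lipschitz gradient on $X$, and $h_i:\mathbb R^n\to(-\infty,\infty]$ is locally Lipschitz continuous and prox-regular at each point of $X$. Put $\varphi_i:=g_i-h_i$; there is a constant $m_{\varphi_0}$ with $\varphi_0\ge m_{\varphi_0}$ on $X$. **Variational notions.** For a lower semicontinuous (l.s.c.) $f:\mathbb R^n\to(-\infty,\infty]$ and $x$ with $f(x)<\infty$, the regular subdifferential is $\hat\partial f(x)=\{v:\liminf_{u\to x}\frac{f(u)-f(x)-\langle v,u-x\rangle}{\|u-x\|}\ge0\}$, and the limiting subdifferential $\partial f(x)$ is the set of all $v$ for which there are $x_k\to x$ with $f(x_k)\to f(x)$ and $v_k\in\hat\partial f(x_k)$ with $v_k\to v$. $f$ is prox-regular at $\bar x$ if $f(\bar x)<\infty$, $f$ is l.s.c. around $\bar x$, and for every $\bar v\in\partial f(\bar x)$ there are $\varepsilon>0$, $r\ge0$ with $f(x')\ge f(x)+\langle v,x'-x\rangle-\frac r2\|x'-x\|^2$ whenever $\|x-\bar x\|\le\varepsilon$, $\|x'-\bar x\|\le\varepsilon$, $f(x)\le f(\bar x)+\varepsilon$, $v\in\partial f(x)$, $\|v-\bar v\|\le\varepsilon$. $\mathcal N_X(x)=\{v:\langle v,x'-x\rangle\le0\ \forall x'\in X\}$ for $x\in X$ and $\mathcal N_X(x)=\emptyset$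 otherwise; $\delta_X$ is the indicator function of $X$. **Stationary point.** A feasible point $\bar x$ of (P) (i.e. $\bar x\in X$, $\varphi_i(\bar x)\le0$ for $i\in\mathcal I$) is a stationary point if there are $\lambda_i\ge0$, $i\in\mathcal I$, with $0\in\nabla g_0(\bar x)-\partial h_0(\bar x)+\sum_{i\in\mathcal I}\lambda_i(\nabla g_i(\bar x)-\partial h_i(\bar x))+\mathcal N_X(\bar x)$ and $\lambda_i\varphi_i(\bar x)=0$ for all $i\in\mathcal I$. **Algorithm CDP-ESQM.** For $p>0$ let $\phi_p(x):=\frac1p\varphi_0(x)+\sum_{i\in\mathcal I}\max\{\varphi_i(x),0\}$. Input: $x^0\in X$, $\beta,\sigma\in(0,1)$, $p_0,\varrho_p,c_p>0$. For $k=0,1,\dots$: 1. Choose $v_i^k\in\partial h_i(x^k)$ for $i\in\{0\}\cup\mathcal I$. 2. Choose a symmetric positive definite $G_k\in\mathbb R^{n\times n}$; it is assumed that there are constants $\alpha,M_G>0$ independent of $k$ with $\alpha\|d\|^2\le\langle G_kd,d\rangle\le M_G\|d\|^2$ for all $d\in\mathbb R^n$, $k\ge0$. 3. With $\tilde\phi_k(x):=\frac1{p_k}\big(\varphi_0(x^k)+\langle\nabla g_0(x^k)-v_0^k,x-x^k\rangle\big)+\sum_{i\in\mathcal I}\max\{\varphi_i(x^k)+\langle\nabla g_i(x^k)-v_i^k,x-x^k\rangle,0\}$, let $d^k$ be the unique minimizer over $d\in\mathbb R^n$ of $\tilde\phi_k(x^k+d)+\frac12\langle G_kd,d\rangle+\delta_X(x^k+d)$.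 4. If $d^k=0$ and $\varphi_i(x^k)\le0$ for all $i\in\mathcal I$, stop and return $x^k$. 5. Set $\tau_k:=\beta^{q_k}$, with $q_k$ the smallest nonnegative integer such that $\phi_{p_k}(x^k+\tau_kd^k)\le\tilde\phi_k(x^k+\tau_kd^k)+(1-\sigma)\alpha\tau_k\|d^k\|^2$. 6. $x^{k+1}:=x^k+\tau_kd^k$. 7. $t^k:=\sum_{i\in\mathcal I}\max\{\varphi_i(x^k)+\langle\nabla g_i(x^k)-v_i^k,d^k\rangle,0\}$; set $p_{k+1}:=p_k+\varrho_p$ if $t^k\ge c_p\|d^k\|$, and $p_{k+1}:=p_k$ otherwise. *)

(* Defs.v *)
From HB Require Import structures.
From mathcomp Require Import all_boot all_order all_algebra.
From mathcomp Require Import all_classical all_reals all_analysis.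

Set Implicit Arguments.
Unset Strict Implicit.
Unset Printing Implicit Defensive.

Import Order.TTheory GRing.Theory Num.Theory.
Import numFieldNormedType.Exports.

Local Open Scope classical_set_scope.
Local Open Scope ring_scope.

(* The library norm on 'rV[R]_n is the sup norm. It is used only through the
   topology, boundedness and local Lipschitz continuity, which do not depend on
   the choice of the norm; every quantitative formula uses [enorm]. *)
Section Euclidean.
Context {R : realType} {n : nat}.
Implicit Types (u v x y : 'rV[R]_n).

Definition dotp u v : R := (u *m v^T) 0 0.

Definition enorm u : R := Num.sqrt (dotp u u).

Definition gradient (g : 'rV[R]_n -> R) x : 'rV[R]_n :=
  \row_j 'D_(delta_mx 0 j) g x.

Definition continuously_differentiable (g : 'rV[R]_n -> R) : Prop :=
  (forall x, differentiable g x) /\ continuous (gradient g).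

Definition locally_lipschitz_on (X : set 'rV[R]_n)
    (F : 'rV[R]_n -> 'rV[R]_n) : Prop :=
  forall x, X x ->
    exists2 U, nbhs x U & [lipschitz F y | y in U `&` X].

(* A row vector [u] is multiplied on the right by [G], which gives the transpose
   of the column [G u^T] when [G] is symmetric. *)
Definition symmetric_posdef (G : 'M[R]_n) : Prop :=
  G^T = G /\ forall u, u != 0 -> 0 < dotp (u *m G) u.

End Euclidean.

Section Variational.
Context {R : realType} {n : nat}.
Implicit Types (f : 'rV[R]_n -> \bar R) (v x y : 'rV[R]_n) (X : set 'rV[R]_n).
Local Open Scope ereal_scope.

Definition locally_lipschitz_at f x : Prop :=
  exists U, [/\ nbhs x U, (forall y, U y -> f y \is a fin_num)
              & [lipschitz (fine (f y)) | y in U]].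

Definition lsc_at f x : Prop :=
  forall a : R, a%:E < f x -> \forall y \near x, a%:E < f y.

Definition regular_subdiff f x : set 'rV[R]_n := [set v |
  f x < +oo /\
  0 <= limf_einf
         (fun u => (f u - f x - (dotp v (u - x)%R)%:E)
                   * ((enorm (u - x))^-1)%:E) x^'].

Definition limiting_subdiff f x : set 'rV[R]_n := [set v |
  f x < +oo /\
  exists (xs vs : nat -> 'rV[R]_n),
    [/\ xs @ \oo --> x, (f \o xs) @ \oo --> f x,
        (forall k, regular_subdiff f (xs k) (vs k)) & vs @ \oo --> v]].

Definition prox_regular f xbar : Prop :=
  [/\ f xbar < +oo,
      (\forall x \near xbar, lsc_at f x) &
      forall vbar, limiting_subdiff f xbar vbar ->
        exists e r : R, [/\ (0 < e)%R, (0 <= r)%R &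
          forall x x' v,
            (enorm (x - xbar) <= e)%R -> (enorm (x' - xbar) <= e)%R ->
            f x <= f xbar + e%:E ->
            limiting_subdiff f x v -> (enorm (v - vbar) <= e)%R ->
            f x + (dotp v (x' - x) - r / 2 * enorm (x' - x) ^+ 2)%:E
              <= f x']].

Definition normal_cone X x : set 'rV[R]_n := [set v |
  X x /\ forall x', X x' -> (dotp v (x' - x) <= 0)%R].

Definition set_indicator X x : \bar R := if `[< X x >] then 0 else +oo.

End Variational.

(* The index set {0} U I is [option I]: [None] is the index 0 of the objective
   and [Some i] is the constraint index i. *)
Section Problem.
Context {R : realType} {n : nat} {I : finType}.
Variables (X : set 'rV[R]_n) (g : option I -> 'rV[R]_n -> R)
  (h : option I -> 'rV[R]_n -> \bar R).
Implicit Types (x xbar : 'rV[R]_n).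
Local Open Scope ereal_scope.

Definition phi (i : option I) x : \bar R := (g i x)%:E - h i x.

Record standing_assumptions : Prop := {
  X_nonempty : X !=set0;
  X_closed : closed X;
  X_convex : convex_set (X : set (convex_lmodType 'rV[R]_n));
  g_C1 : forall i, continuously_differentiable (g i);
  g_grad_lipschitz : forall i, locally_lipschitz_on X (gradient (g i));
  h_gt_ninfty : forall i x, -oo < h i x;
  h_lipschitz : forall i x, X x -> locally_lipschitz_at (h i) x;
  h_prox_regular : forall i x, X x -> prox_regular (h i) x;
  phi0_bounded_below : exists m : R, forall x, X x -> m%:E <= phi None x
}.

Definition feasible x : Prop := X x /\ forall i, phi (Some i) x <= 0.

(* Membership of 0 in a sum of sets is spelled out: [w i] is the chosen element
   of the subdifferential of [h i] and [z] that of the normal cone. *)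
Definition stationary_point xbar : Prop :=
  feasible xbar /\
  exists lambda : I -> R,
    [/\ forall i, (0 <= lambda i)%R,
        exists (w : option I -> 'rV[R]_n) (z : 'rV[R]_n),
          [/\ forall i, limiting_subdiff (h i) xbar (w i),
              normal_cone X xbar z &
              (0 = gradient (g None) xbar - w None
                   + \sum_i lambda i
                       *: (gradient (g (Some i)) xbar - w (Some i))
                   + z)%R] &
        forall i, (lambda i)%:E * phi (Some i) xbar = 0].

Definition violation_stationary_point xbar : Prop :=
  exists lambda : I -> R,
    [/\ forall i, (0 <= lambda i <= 1)%R,
        forall i, phi (Some i) xbar < 0 -> lambda i = 0%R,
        forall i, 0 < phi (Some i) xbar -> lambda i = 1%R &
        exists (w : I -> 'rV[R]_n) (z : 'rV[R]_n),
          [/\ forall i, limiting_subdiff (h (Some i)) xbar (w i),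
              normal_cone X xbar z &
              (0 = \sum_i lambda i *: (gradient (g (Some i)) xbar - w i)
                   + z)%R]].

Definition penalty (p : R) x : \bar R :=
  (p^-1)%:E * phi None x + \sum_i maxe (phi (Some i) x) 0.

(* [xk] is the current iterate, [v] the subgradients chosen there and [d] the
   displacement from [xk]. *)
Definition linearization (xk : 'rV[R]_n) (v : option I -> 'rV[R]_n)
    (i : option I) (d : 'rV[R]_n) : \bar R :=
  phi i xk + (dotp (gradient (g i) xk - v i) d)%:E.

Definition linearized_infeasibility xk v d : \bar R :=
  \sum_i maxe (linearization xk v (Some i) d) 0.

Definition penalty_model (p : R) xk v x : \bar R :=
  (p^-1)%:E * linearization xk v None (x - xk)%R
    + linearized_infeasibility xk v (x - xk)%R.

Definition subproblem (p : R) xk v (G : 'M[R]_n) (d : 'rV[R]_n) : \bar R :=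
  penalty_model p xk v (xk + d)%R
    + (2^-1 * dotp (d *m G) d)%:E + set_indicator X (xk + d)%R.

Definition minimizer (F : 'rV[R]_n -> \bar R) (d : 'rV[R]_n) : Prop :=
  forall d', F d <= F d'.

Section Run.
Variables (alpha MG beta sigma rho c : R).
Variables (x0 : 'rV[R]_n) (p0 : R).
Variables (x : nat -> 'rV[R]_n) (p : nat -> R)
  (v : nat -> option I -> 'rV[R]_n) (G : nat -> 'M[R]_n)
  (d : nat -> 'rV[R]_n) (q : nat -> nat).

Definition stop (k : nat) : Prop :=
  d k = 0%R /\ forall i, phi (Some i) (x k) <= 0.

Definition reached (k : nat) : Prop := forall j, (j < k)%N -> ~ stop j.

Definition terminates_at (k : nat) : Prop := reached k /\ stop k.

Definition sufficient_decrease (k j : nat) : Prop :=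
  let tau := (beta ^+ j)%R in
  penalty (p k) (x k + tau *: d k)%R
    <= penalty_model (p k) (x k) (v k) (x k + tau *: d k)%R
       + ((1 - sigma) * alpha * tau * enorm (d k) ^+ 2)%:E.

(* Iteration [k] is entered when [reached k]. The line search and the updates
   are performed when moreover the test fails at [k], i.e. when
   [reached k.+1]. The values of the sequences past termination are
   irrelevant. *)
Record cdp_esqm_run : Prop := {
  alpha_gt0 : (0 < alpha)%R;
  MG_gt0 : (0 < MG)%R;
  beta_in01 : (0 < beta < 1)%R;
  sigma_in01 : (0 < sigma < 1)%R;
  rho_gt0 : (0 < rho)%R;
  c_gt0 : (0 < c)%R;
  p0_gt0 : (0 < p0)%R;
  x0_in_X : X x0;
  x_init : x 0 = x0;
  p_init : p 0 = p0;
  v_subgradient : forall k, reached k ->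
    forall i, limiting_subdiff (h i) (x k) (v k i);
  G_symmetric_posdef : forall k, reached k -> symmetric_posdef (G k);
  G_bounds : forall k, reached k -> forall u : 'rV[R]_n,
    (alpha * enorm u ^+ 2 <= dotp (u *m G k) u <= MG * enorm u ^+ 2)%R;
  d_minimizer : forall k, reached k ->
    unique (minimizer (subproblem (p k) (x k) (v k) (G k))) (d k);
  q_smallest : forall k, reached k.+1 ->
    sufficient_decrease k (q k)
    /\ forall j, (j < q k)%N -> ~ sufficient_decrease k j;
  x_update : forall k, reached k.+1 -> x k.+1 = (x k + beta ^+ q k *: d k)%R;
  p_update : forall k, reached k.+1 ->
    p k.+1 = if (c * enorm (d k))%:E
                  <= linearized_infeasibility (x k) (v k) (d k)
             then (p k + rho)%R else p k
}.

End Run.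
End Problem.

(* Main.v *)
(* Comparing the minimizer [d k] of the strongly convex subproblem with nearby
   points of the segment from [0] to [d k] gives a model decrease of at least
   [alpha |d k|^2]; with the line search, the penalty function shifted by the
   lower bound of the objective decreases by [sigma alpha tau_k |d k|^2], so
   [tau_k |d k|^2] and the steps [x (k+1) - x k] tend to 0. Along a convergent
   subsequence the subgradients stay bounded and prox-regularity is uniform, so
   every phi_i lies below its linearization up to a quadratic error; hence the
   step sizes stay bounded away from 0 and [d k] tends to 0. All limits are
   taken along an ultrafilter finer than the subsequence. The optimality of the
   subproblems passes to the limit, with [1 / p k] tending to some [pi >= 0],
   and a minimum of [pi <s, .> + sum_i max (a_i + <s_i, .>, 0)] over [X] yields
   the multipliers by eliminating one maximum at a time. The cluster set is
   connected because a sequence with vanishing steps that leaves a set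
   infinitely often has a cluster point on the boundary of that set. *)

Require Import Defs.
From HB Require Import structures.
From mathcomp Require Import all_boot all_order all_algebra.
From mathcomp Require Import all_classical all_reals all_analysis.
From mathcomp Require Import ring lra.

Set Implicit Arguments.
Unset Strict Implicit.
Unset Printing Implicit Defensive.

Import Order.TTheory GRing.Theory Num.Theory.
Import numFieldNormedType.Exports.

Local Open Scope classical_set_scope.
Local Open Scope ring_scope.

(** * Dot product and Euclidean norm, compared with the sup norm *)

Lemma cvg_sumr {R : realType} {T I : Type} {F : set_system T}
    {FF : Filter F} (r : seq I) (f : I -> T -> R) (l : I -> R) :
  (forall i, f i @ F --> l i) ->
  \sum_(i <- r) f i t @[t --> F] --> \sum_(i <- r) l i.
Proof.
move=> fl; elim: r => [|i r IH].
  by rewrite big_nil; under eq_fun do rewrite big_nil; exact: cvg_cst.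
by rewrite big_cons; under eq_fun do rewrite big_cons; exact: cvgD (fl i) IH.
Qed.

Section EuclideanTheory.
Context {R : realType} {n : nat}.
Implicit Types (u v w x y : 'rV[R]_n) (a : R).

Lemma dotpE u v : dotp u v = \sum_j u 0 j * v 0 j.
Proof. by rewrite /dotp mxE; apply: eq_bigr => j _; rewrite mxE. Qed.

Lemma dotpC u v : dotp u v = dotp v u.
Proof. by rewrite !dotpE; apply: eq_bigr => j _; rewrite mulrC. Qed.

Lemma dotpDl u v w : dotp (u + v) w = dotp u w + dotp v w.
Proof. by rewrite /dotp mulmxDl mxE. Qed.

Lemma dotpDr u v w : dotp u (v + w) = dotp u v + dotp u w.
Proof. by rewrite dotpC dotpDl !(dotpC u). Qed.

Lemma dotpZl a u v : dotp (a *: u) v = a * dotp u v.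
Proof. by rewrite /dotp -scalemxAl mxE. Qed.

Lemma dotpZr a u v : dotp u (a *: v) = a * dotp u v.
Proof. by rewrite dotpC dotpZl dotpC. Qed.

Lemma dotpNl u v : dotp (- u) v = - dotp u v.
Proof. by rewrite -scaleN1r dotpZl mulN1r. Qed.

Lemma dotpNr u v : dotp u (- v) = - dotp u v.
Proof. by rewrite dotpC dotpNl dotpC. Qed.

Lemma dotp0l v : dotp 0 v = 0.
Proof. by rewrite -(scale0r v) dotpZl mul0r. Qed.

Lemma dotp0r v : dotp v 0 = 0.
Proof. by rewrite dotpC dotp0l. Qed.

Lemma dotp_suml (I : finType) (f : I -> 'rV[R]_n) v :
  dotp (\sum_i f i) v = \sum_i dotp (f i) v.
Proof.
by apply: (big_morph (dotp^~ v)); [move=> a b; exact: dotpDl|exact: dotp0l].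
Qed.

Lemma dotp_ge0 u : 0 <= dotp u u.
Proof. by rewrite dotpE; apply: sumr_ge0 => j _; rewrite -expr2 sqr_ge0. Qed.

Lemma enorm_sqr u : enorm u ^+ 2 = dotp u u.
Proof. by rewrite sqr_sqrtr // dotp_ge0. Qed.

Lemma enorm_ge0 u : 0 <= enorm u.
Proof. exact: sqrtr_ge0. Qed.

Lemma enorm0 : enorm (0 : 'rV[R]_n) = 0.
Proof. by rewrite /enorm dotp0l sqrtr0. Qed.

Lemma enormZ a u : enorm (a *: u) = `|a| * enorm u.
Proof.
by rewrite /enorm dotpZl dotpZr mulrA -expr2 sqrtrM ?sqr_ge0// sqrtr_sqr.
Qed.

Lemma norm_row_le u j : `|u 0 j| <= `|u|.
Proof.
rewrite [leRHS]/Num.norm/= mx_normrE.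
by apply: (le_bigmax _ (fun i : 'I_1 * 'I_n => `|u i.1 i.2|) (ord0, j)).
Qed.

Lemma norm_le_enorm u : `|u| <= enorm u.
Proof.
rewrite [leLHS]/Num.norm/= mx_normrE; apply/bigmax_leP; split.
  exact: enorm_ge0.
move=> [i j] _ /=; rewrite (ord1 i) -sqrtr_sqr ler_wsqrtr//.
rewrite dotpE (bigD1 j)//= -expr2 lerDl.
by apply: sumr_ge0 => k _; rewrite -expr2 sqr_ge0.
Qed.

Lemma dotp_norm_le u v : `|dotp u v| <= n%:R * `|u| * `|v|.
Proof.
rewrite dotpE (le_trans (ler_norm_sum _ _ _))//.
apply: (@le_trans _ _ (\sum_(j < n) `|u| * `|v|)).
  by apply: ler_sum => j _; rewrite normrM ler_pM// norm_row_le.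
by rewrite sumr_const card_ord -mulrA mulr_natl.
Qed.

(** The constant [n.+1] rather than [n] stays positive in dimension 0, so that one can divide by
    it. *)
Lemma enorm_le_norm u : enorm u <= n.+1%:R * `|u|.
Proof.
rewrite -[leRHS](ger0_norm) ?mulr_ge0// -sqrtr_sqr ler_wsqrtr//.
rewrite (le_trans (ler_norm _))// (le_trans (dotp_norm_le _ _))//.
rewrite exprMn -mulrA -[`|u| * `|u|]expr2 ler_wpM2r ?sqr_ge0//.
by rewrite -natrX ler_nat expnS expn1 -{1}(muln1 n) leq_mul.
Qed.

Lemma cvg_dotp {T : Type} {F : set_system T} {FF : Filter F}
    (f g : T -> 'rV[R]_n) u v :
  f @ F --> u -> g @ F --> v -> dotp (f t) (g t) @[t --> F] --> dotp u v.
Proof.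
move=> fu gv; rewrite dotpE; under eq_fun do rewrite dotpE.
have entry (k : T -> 'rV[R]_n) w (j : 'I_n) :
    k @ F --> w -> k t 0 j @[t --> F] --> w 0 j.
  by move=> kw; apply: (cvg_comp _ _ kw (@coord_continuous _ _ _ 0 j w)).
by apply: cvg_sumr => j; apply: cvgM; apply: entry.
Qed.

Lemma cvg_enorm0 {T : Type} {F : set_system T} {FF : Filter F}
    (f : T -> 'rV[R]_n) :
  enorm (f t) @[t --> F] --> (0 : R) -> f @ F --> (0 : 'rV[R]_n).
Proof.
move=> f0; apply/norm_cvg0P.
apply: (squeeze_cvgr _ (cvg_cst _) f0).
by apply: nearW => t; rewrite normr_ge0 norm_le_enorm.
Qed.

End EuclideanTheory.

(** * Multipliers for a sum of positive parts *)

Section Multipliers.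
Context {R : realType} {V : lmodType R}.
Implicit Types (K : set V) (y z : V) (t : R) (f l : V -> R).

Definition segment_closed K := forall y z t,
  K y -> K z -> 0 <= t -> t <= 1 -> K ((1 - t) *: y + t *: z).

Definition convex_fun_on K f := forall y z t,
  K y -> K z -> 0 <= t -> t <= 1 ->
  f ((1 - t) *: y + t *: z) <= (1 - t) * f y + t * f z.

Definition affine_fun l := forall y z t,
  l ((1 - t) *: y + t *: z) = (1 - t) * l y + t * l z.

Lemma convex_fun_onD K f1 f2 :
  convex_fun_on K f1 -> convex_fun_on K f2 ->
  convex_fun_on K (fun y => f1 y + f2 y).
Proof.
move=> c1 c2 y z t Ky Kz t0 t1.
have := c1 _ _ _ Ky Kz t0 t1; have := c2 _ _ _ Ky Kz t0 t1; lra.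
Qed.

Lemma affine_convex K l : affine_fun l -> convex_fun_on K l.
Proof. by move=> al y z t _ _ _ _; rewrite al. Qed.

Lemma convex_fun_on_max0 K f :
  convex_fun_on K f -> convex_fun_on K (fun y => Num.max (f y) 0).
Proof.
move=> cf y z t Ky Kz t0 t1; rewrite ge_max; apply/andP; split; last first.
  by rewrite addr_ge0// mulr_ge0 ?subr_ge0// le_max lexx orbT.
apply: le_trans (cf _ _ _ Ky Kz t0 t1) _.
by rewrite lerD// ler_wpM2l ?subr_ge0// le_max lexx.
Qed.

Lemma convex_fun_on_sum (I : Type) (s : seq I) K (f : I -> V -> R) :
  (forall i, convex_fun_on K (f i)) ->
  convex_fun_on K (fun y => \sum_(i <- s) f i y).
Proof.
move=> cf; elim: s => [|i s IH].
  by move=> y z t *; rewrite !big_nil !mulr0 addr0.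
move=> y z t *; rewrite !big_cons.
exact: (convex_fun_onD (cf i) IH).
Qed.

(* The admissible [lam] form the interval between the supremum of [- f / l] over
   [l > 0] and the infimum of the same quotient over [l < 0]; it is nonempty
   because a segment from [l > 0] to [l < 0] meets [l = 0], where [f >= 0]. *)
Lemma max0_multiplier K f l :
  segment_closed K -> convex_fun_on K f -> affine_fun l ->
  (forall y, K y -> 0 <= f y + Num.max (l y) 0) ->
  exists2 lam : R, 0 <= lam <= 1 & forall y, K y -> 0 <= f y + lam * l y.
Proof.
move=> sK cf al fl.
pose S : set R := [set r | r = 0 \/
  exists2 y, K y /\ 0 < l y & r = - f y / l y].
have S0 : S 0 by left.
have fpos y : K y -> l y <= 0 -> 0 <= f y.
  by move=> Ky ly; have := fl y Ky; rewrite max_r// addr0.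
have Sub1 : ubound S 1.
  move=> r [->|[y [Ky ly] ->]]; first exact: ler01.
  rewrite ler_pdivrMr// mul1r.
  have := fl y Ky; rewrite (max_l (ltW ly)); lra.
have hS : has_sup S by split; [exists 0|exists 1].
have ubneg z : K z -> l z < 0 -> ubound S (- f z / l z).
  move=> Kz lz r [->|[y [Ky ly] ->]].
    by rewrite mulNr -mulrN -invrN divr_ge0 ?fpos ?oppr_ge0 ?ltW.
  pose t := l y / (l y - l z).
  have D : 0 < l y - l z by lra.
  have t0 : 0 <= t by rewrite divr_ge0 ?ltW.
  have t1 : t <= 1 by rewrite ler_pdivrMr//; lra.
  have lw : l ((1 - t) *: y + t *: z) = 0.
    by rewrite al /t; field; apply: lt0r_neq0.
  have := fpos _ (sK _ _ _ Ky Kz t0 t1); rewrite lw => /(_ (lexx _)) fw.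
  have := le_trans fw (cf _ _ _ Ky Kz t0 t1).
  have -> : (1 - t) * f y + t * f z
      = (l y * f z - l z * f y) / (l y - l z).
    by rewrite /t; field; apply: lt0r_neq0.
  rewrite pmulr_lge0 ?invr_gt0// => H.
  rewrite ler_pdivrMr// mulrAC ler_ndivlMr//; lra.
exists (sup S).
  by apply/andP; split; [exact: ub_le_sup hS.2 _ S0|exact: ge_sup hS.1 Sub1].
move=> y Ky; have [ly|ly|ly] := ltgtP (l y) 0.
- have : sup S <= - f y / l y by apply: ge_sup (ubneg y Ky ly); exists 0.
  rewrite ler_ndivlMr//; lra.
- have : - f y / l y <= sup S.
    by apply: ub_le_sup; [exists 1|right; exists y].
  rewrite ler_pdivrMr//; lra.
- by rewrite ly mulr0 addr0 fpos// ly.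
Qed.

(** Induction on [s]: the maxima not yet treated are convex and join [f] while the first one is
    eliminated. The resulting affine term [a * l i] then joins [f] for the induction hypothesis. *)
Lemma sum_max0_multipliers (I : eqType) (s : seq I) K f (l : I -> V -> R) :
  uniq s -> segment_closed K -> convex_fun_on K f ->
  (forall i, affine_fun (l i)) ->
  (forall y, K y -> 0 <= f y + \sum_(i <- s) Num.max (l i y) 0) ->
  exists2 lam : I -> R, (forall i, 0 <= lam i <= 1) &
    forall y, K y -> 0 <= f y + \sum_(i <- s) lam i * l i y.
Proof.
move=> us sK cf al; elim: s us f cf => [_ f cf|i s IH /andP[nis us] f cf] fl.
  exists (fun=> 0); first by move=> _; rewrite lexx ler01.
  by move=> y Ky; have := fl y Ky; rewrite !big_nil.
pose f1 y := f y + \sum_(j <- s) Num.max (l j y) 0.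
have cf1 : convex_fun_on K f1.
  apply: convex_fun_onD => //; apply: convex_fun_on_sum => j.
  by apply: convex_fun_on_max0; exact: affine_convex.
have [y Ky|a a01 fa] := max0_multiplier sK cf1 (al i).
  by have := fl y Ky; rewrite big_cons /f1; lra.
have cf2 : convex_fun_on K (fun y => f y + a * l i y).
  apply: convex_fun_onD => // y z t *; rewrite al; lra.
have [y Ky|lam lam01 flam] := IH us _ cf2.
  by have := fa y Ky; rewrite /f1; lra.
(* Uniqueness of [i :: s] ensures that overwriting [lam] at [i] leaves the sum over [s]
   unchanged. *)
exists (fun j => if j == i then a else lam j).
  by move=> j; case: ifP.
move=> y Ky; rewrite big_cons eqxx addrA.
rewrite (eq_big_seq (fun j => lam j * l j y)); first exact: flam.
by move=> j js; case: eqP => // ji; rewrite -ji js in nis.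
Qed.

End Multipliers.

Section SegmentMinimum.
Context {R : realType} {n : nat} {I : finType}.
Variables (X : set 'rV[R]_n) (x s0 : 'rV[R]_n) (a : I -> R)
  (s : I -> 'rV[R]_n).

Lemma affine_dotp_sub (b : R) (w : 'rV[R]_n) :
  affine_fun (fun y => b + dotp w (y - x)).
Proof.
move=> y z t; rewrite !(dotpDr, dotpNr, dotpZr); ring.
Qed.

Lemma multipliers_of_minimum (pi : R) :
  segment_closed X -> X x ->
  (forall y, X y -> \sum_i Num.max (a i) 0 <= pi * dotp s0 (y - x)
     + \sum_i Num.max (a i + dotp (s i) (y - x)) 0) ->
  exists2 lam : I -> R, (forall i, [/\ 0 <= lam i <= 1,
       a i < 0 -> lam i = 0 & 0 < a i -> lam i = 1]) &
    normal_cone X x (- (pi *: s0 + \sum_i lam i *: s i)).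
Proof.
move=> sX Xx xmin.
pose f y := - \sum_i Num.max (a i) 0 + pi * dotp s0 (y - x).
pose l i y := a i + dotp (s i) (y - x).
have cf : convex_fun_on X f.
  apply: affine_convex => y z t.
  rewrite /f !(dotpDr, dotpNr, dotpZr); ring.
have fl y : X y ->
    0 <= f y + \sum_(i <- index_enum I) Num.max (l i y) 0.
  by move=> Xy; have := xmin y Xy; rewrite /f /l; lra.
have [lam lam01 flam] := sum_max0_multipliers (l := l) (index_enum_uniq I) sX cf
  (fun i => affine_dotp_sub (a i) (s i)) fl.
(* Each product is at most the positive part, and the multiplier inequality at [y = x] gives the
   reverse bound for the sums. Hence equality holds termwise, which is complementarity. *)
have comp i : lam i * a i = Num.max (a i) 0.
  have le j : lam j * a j <= Num.max (a j) 0.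
    have /andP[l0 l1] := lam01 j; case: (lerP (a j) 0) => aj.
      by rewrite mulr_ge0_le0.
    by rewrite ger_pMl.
  have : \sum_i (Num.max (a i) 0 - lam i * a i) = 0.
    apply/eqP; rewrite eq_le; apply/andP; split; last first.
      by apply: sumr_ge0 => j _; rewrite subr_ge0.
    rewrite sumrB; have := flam x Xx; rewrite /f subrr dotp0r mulr0 addr0.
    have -> : \sum_i lam i * l i x = \sum_i lam i * a i.
      by apply: eq_bigr => j _; rewrite /l subrr dotp0r addr0.
    lra.
  move/eqP; rewrite psumr_eq0 => [|j _]; last by rewrite subr_ge0.
  by move=> /allP/(_ i (mem_index_enum i)); rewrite subr_eq0 => /eqP.
exists lam => [i|].
  split=> // ai; have := comp i.
    rewrite (max_r (ltW ai)) => /eqP; rewrite mulf_eq0 (lt_eqF ai) orbF.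
    by move/eqP.
  rewrite (max_l (ltW ai)) -[RHS]mul1r => /mulIf; apply; exact: lt0r_neq0.
split=> // y Xy; rewrite dotpNl dotpDl dotpZl dotp_suml oppr_le0.
have := flam y Xy; rewrite /f.
have -> : \sum_i lam i * l i y
    = \sum_i Num.max (a i) 0 + \sum_i dotp (lam i *: s i) (y - x).
  rewrite -big_split/=; apply: eq_bigr => i _.
  by rewrite mulrDr comp dotpZl.
lra.
Qed.

(* A remainder quadratic along segments does not matter: the first-order part is
   convex, so dividing by [t] and letting [t] tend to [0] removes it. *)
Lemma multipliers_of_segment_minimum (pi : R) (Q : 'rV[R]_n -> R) :
  segment_closed X -> X x ->
  (forall y t, X y -> 0 < t -> t <= 1 ->
     \sum_i Num.max (a i) 0 <= t * (pi * dotp s0 (y - x))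
     + \sum_i Num.max (a i + t * dotp (s i) (y - x)) 0 + t ^+ 2 * Q y) ->
  exists2 lam : I -> R, (forall i, [/\ 0 <= lam i <= 1,
       a i < 0 -> lam i = 0 & 0 < a i -> lam i = 1]) &
    normal_cone X x (- (pi *: s0 + \sum_i lam i *: s i)).
Proof.
move=> sX Xx xmin; apply: multipliers_of_minimum => // y Xy.
set A := \sum_i Num.max (a i) 0; set D := _ * dotp _ _.
set B := \sum_i _.
have seg t : 0 < t -> t <= 1 -> A <= D + B + t * Q y.
  move=> t0 t1; have := xmin y t Xy t0 t1; rewrite -/A -/D => H.
  (* The positive part is convex, and its argument is the combination of [a i] and
     [a i + dotp (s i) (y - x)] with weights [1 - t] and [t]. *)
  have : \sum_i Num.max (a i + t * dotp (s i) (y - x)) 0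
      <= (1 - t) * A + t * B.
    rewrite /A /B !mulr_sumr -big_split/=; apply: ler_sum => i _.
    rewrite !maxr_pMr ?subr_ge0 ?(ltW t0)// !mulr0.
    have [u|u] := leP ((1 - t) * a i) 0; have [w|w] := leP
      (t * (a i + dotp (s i) (y - x))) 0; rewrite ge_max; lra.
  move=> H2; rewrite -(ler_pM2l t0); nra.
apply/ler_addgt0Pr => e e0.
pose t := Num.min 1 (e / (`|Q y| + 1)).
have Q1 : 0 < `|Q y| + 1 by rewrite ltr_wpDl.
have t0 : 0 < t by rewrite lt_min ltr01 divr_gt0.
have t1 : t <= 1 by rewrite ge_min lexx.
apply: le_trans (seg t t0 t1) _; rewrite lerD2l.
have te : t * (`|Q y| + 1) <= e by rewrite -ler_pdivlMr// ge_min lexx orbT.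
apply: le_trans te; rewrite ler_pM2l//.
by rewrite (le_trans (ler_norm _))// lerDl.
Qed.

End SegmentMinimum.

(** * Limiting subgradients of locally Lipschitz functions *)

(** The closed ball is compact, so the image filter has a cluster point, and a cluster point of an
    ultrafilter is a limit. This replaces every extraction of a subsequence. *)
Lemma ultra_bounded_cvg {R : realType} {n : nat} {T : Type}
    (F : set_system T) (f : T -> 'rV[R]_n) (M : R) :
  UltraFilter F -> (\forall t \near F, `|f t| <= M) ->
  exists l : 'rV[R]_n, f @ F --> l.
Proof.
move=> FU fM; have FP : ProperFilter F := ultra_proper.
have cB : compact (closed_ball_ (fun y : 'rV[R]_n => `|y|) 0 M).
  apply: bounded_closed_compact; last exact: closed_closed_ball_.
  exists M; split; first exact: num_real.
  move=> M' MM' y; rewrite /closed_ball_/= sub0r normrN => yM.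
  exact: le_trans yM (ltW MM').
have [|l [_ fl]] := cB (f @ F) _.
  apply: filterS fM => t ft; suff : `|0 - f t| <= M by [].
  by rewrite sub0r normrN.
exists l => B Bl.
have [//|FnB] := in_ultra_setVsetC (f @^-1` B) FU.
by have [y []] := fl (~` B) B FnB Bl.
Qed.

Section Subdifferentials.
Context {R : realType} {n : nat}.
Implicit Types (f : 'rV[R]_n -> \bar R) (x y z v : 'rV[R]_n).

Lemma lipschitz_bound {W : normedModType R} (k : 'rV[R]_n -> W)
    (A : set 'rV[R]_n) :
  [lipschitz k y | y in A] ->
  exists2 L : R, 0 < L & forall y z, A y -> A z ->
    `|k y - k z| <= L * `|y - z|.
Proof.
move=> [M [_ kM]]; exists (`|M| + 1); first by rewrite ltr_wpDl.
move=> y z Ay Az.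
by apply: (kM _ _ (y, z)) => //; rewrite (le_lt_trans (ler_norm _))// ltrDl.
Qed.

Lemma locally_lipschitz_ball f x :
  locally_lipschitz_at f x ->
  exists r L : R, [/\ 0 < r, 0 < L,
    forall y, ball x r y -> f y \is a fin_num &
    forall y z, ball x r y -> ball x r z ->
      `|fine (f y) - fine (f z)| <= L * `|y - z|].
Proof.
move=> [U [Ux Uf /lipschitz_bound[L L0 UL]]].
have /nbhs_ballP[r r0 rU] := Ux.
by exists r, L; split=> // [y /rU|y z /rU Uy /rU Uz]; [exact: Uf|exact: UL].
Qed.

Lemma locally_lipschitz_cvg f x :
  locally_lipschitz_at f x -> fine (f y) @[y --> x] --> fine (f x).
Proof.
move=> /locally_lipschitz_ball[r [L [r0 L0 _ rL]]].
apply/(@cvgrPdist_lt _ _ _ _ (nbhs_filter x)) => e e0.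
have eL : 0 < Num.min r (e / L) by rewrite lt_min r0 divr_gt0.
apply: filterS (nbhsx_ballx x _ eL) => y; rewrite -ball_normE/= lt_min.
move=> /andP[xyr xye].
have xx : ball x r x by exact: ballxx.
have yr : ball x r y by rewrite -ball_normE.
by rewrite (le_lt_trans (rL _ _ xx yr))// mulrC -ltr_pdivlMr.
Qed.

Lemma locally_lipschitz_fin_near f x :
  locally_lipschitz_at f x -> \forall y \near x, f y \is a fin_num.
Proof. by move=> [U [Ux Uf _]]; apply: filterS Ux. Qed.

Lemma locally_lipschitz_fin f x :
  locally_lipschitz_at f x -> f x \is a fin_num.
Proof. by move=> /locally_lipschitz_fin_near/nbhs_singleton. Qed.

Lemma locally_lipschitz_ecvg f x :
  locally_lipschitz_at f x -> f y @[y --> x] --> f x.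
Proof.
move=> fx; rewrite -(fineK (locally_lipschitz_fin fx)).
apply/(@fine_cvgP _ _ (nbhs x)); split; first exact: locally_lipschitz_fin_near.
exact: locally_lipschitz_cvg.
Qed.

(** Since the lower limit of the quotients exceeds [- e], so does their infimum on some punctured
    neighbourhood. At [y = x] both sides agree. *)
Lemma regular_subdiff_lower f x v (e : R) :
  (\forall y \near x, f y \is a fin_num) -> regular_subdiff f x v -> 0 < e ->
  \forall y \near x,
    fine (f x) + dotp v (y - x) - e * enorm (y - x) <= fine (f y).
Proof.
move=> fin [_]; rewrite limf_einfE => sub e0.
have fx : f x \is a fin_num := nbhs_singleton fin.
have : ((- e)%:E < ereal_sup [set ereal_inf
    [set (f u - f x - (dotp v (u - x)%R)%:E) * ((enorm (u - x))^-1)%:E | u in V]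
      | V in x^'])%E.
  by apply: lt_le_trans sub; rewrite lte_fin oppr_lt0.
move=> /ereal_sup_gt[_ [V xV <-]] eV.
have {}xV : \forall y \near x, y != x -> V y by [].
near=> y.
have [->|yx] := eqVneq y x; first by rewrite subrr dotp0r enorm0 mulr0 addr0 subr0.
have Vy : V y by move: yx; near: y.
have fy : f y \is a fin_num by near: y.
have := lt_le_trans eV (ereal_inf_lbound (imageP _ Vy)).
rewrite -(fineK fx) -(fineK fy) lte_fin => /ltW.
have ny : 0 < enorm (y - x).
  apply: lt_le_trans (norm_le_enorm _).
  by rewrite normr_gt0 subr_eq0.
rewrite ler_pdivlMr//=; lra.
Unshelve. all: by end_near. Qed.

(** Moving from [y] by a small [t *: v] raises [f] by at least [t * (|v|^2 - |v|)], by the lower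
    estimate with slack 1, and by at most [t * L * |v|], by the Lipschitz bound. *)
Lemma regular_subdiff_bounded f x y v (r L : R) :
  (forall y, ball x r y -> f y \is a fin_num) ->
  (forall y z, ball x r y -> ball x r z ->
      `|fine (f y) - fine (f z)| <= L * `|y - z|) -> 0 < L ->
  ball x r y -> regular_subdiff f y v -> enorm v <= L + 1.
Proof.
move=> fin lip L0 xy sub.
have near_y : \forall z \near y, ball x r z.
  by apply: open_nbhs_nbhs; split=> //; exact: ball_open.
have finy : \forall z \near y, f z \is a fin_num.
  by near=> z; apply: fin; near: z.
have low := regular_subdiff_lower finy sub ltr01.
have tv : (fun t : R => y + t *: v) @ (0:R) --> y.
  rewrite -[X in _ --> X]addr0 -(scale0r v).
  by apply: cvgD; [exact: cvg_cst|apply: cvgZl].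
have [t t0 [bt lt]] : exists2 t : R, 0 < t & ball x r (y + t *: v) /\
    fine (f y) + dotp v (y + t *: v - y) - 1 * enorm (y + t *: v - y)
      <= fine (f (y + t *: v)).
  have : \forall t \near (0:R)^'+, ball x r (y + t *: v) /\
    fine (f y) + dotp v (y + t *: v - y) - 1 * enorm (y + t *: v - y)
      <= fine (f (y + t *: v)).
    exact: (cvg_at_right_filter tv) _ (filterI near_y low).
  move=> H; near (0:R)^'+ => t.
  by exists t => //; near: t.
have ytv : y + t *: v - y = t *: v by rewrite addrAC subrr add0r.
move: lt; rewrite ytv dotpZr enormZ gtr0_norm// mul1r => lt.
have := lip _ _ bt xy; rewrite ytv normrZ gtr0_norm// => lt2.
have lt3 : L * (t * `|v|) <= L * (t * enorm v).
  by rewrite !ler_pM2l// norm_le_enorm.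
have lt4 := ler_norm (fine (f (y + t *: v)) - fine (f y)).
have lt5 : t * (enorm v * enorm v) <= t * ((L + 1) * enorm v).
  by rewrite -!expr2 enorm_sqr; lra.
rewrite ler_pM2l// in lt5.
have [/eqP ->|v0] := boolP (enorm v == 0); first lra.
by rewrite -(ler_pM2r (x := enorm v))// lt0r v0 enorm_ge0.
Unshelve. all: by end_near. Qed.

Lemma limiting_subdiff_approx f x v (e : R) :
  limiting_subdiff f x v -> 0 < e ->
  exists y w, [/\ `|x - y| < e, `|v - w| < e & regular_subdiff f y w].
Proof.
move=> [_ [xs [vs [xsx _ reg vsv]]]] e0.
move/cvgrPdist_lt : xsx => /(_ e e0) xsx.
move/cvgrPdist_lt : vsv => /(_ e e0) vsv.
near \oo => k; exists (xs k), (vs k); split=> //; near: k => //.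
Unshelve. all: by end_near. Qed.

(** The convergence of the values of [f] required in the definition is automatic by continuity. This
    sequence-free criterion allows limits along arbitrary filters. *)
Lemma limiting_subdiff_of_approx f x v :
  locally_lipschitz_at f x ->
  (forall e : R, 0 < e ->
    exists y w, [/\ `|x - y| < e, `|v - w| < e & regular_subdiff f y w]) ->
  limiting_subdiff f x v.
Proof.
move=> fx app; split.
  by rewrite ltey_eq locally_lipschitz_fin.
have /choice[yw yw_app] : forall k : nat, exists yw : 'rV[R]_n * 'rV[R]_n,
    [/\ `|x - yw.1| < k.+1%:R^-1, `|v - yw.2| < k.+1%:R^-1
      & regular_subdiff f yw.1 yw.2].
  by move=> k; have [//|y [w ?]] := app k.+1%:R^-1; exists (y, w).
have cvg_app (u : nat -> 'rV[R]_n) (l : 'rV[R]_n) :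
    (forall k, `|l - u k| < k.+1%:R^-1) -> u @ \oo --> l.
  move=> ul; apply/cvgrPdist_lt => e e0; near=> k.
  apply: lt_trans (ul k) _; near: k.
  exact: near_infty_natSinv_lt (PosNum e0).
exists (fst \o yw), (snd \o yw).
have c1 : (fst \o yw) @ \oo --> x.
  by apply: cvg_app => k; have [] := yw_app k.
split=> //; last by apply: cvg_app => k; have [] := yw_app k.
- by apply: cvg_comp c1 _; exact: locally_lipschitz_ecvg.
- by move=> k; have [] := yw_app k.
Unshelve. all: by end_near. Qed.

Lemma limiting_subdiff_bounded f x :
  locally_lipschitz_at f x ->
  exists M : R, \forall y \near x, forall v, limiting_subdiff f y v -> `|v| <= M.
Proof.
move=> /locally_lipschitz_ball[r [L [r0 L0 fin lip]]].
(* Regular subgradients near [x] are bounded by [L + 1]; the remaining 1 pays for approximating a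
   limiting subgradient by a regular one. *)
exists (L + 2).
have nr : \forall y \near x, nbhs y (ball x r).
  apply: filterS (nbhsx_ballx x r r0) => y xy.
  by apply: open_nbhs_nbhs; split=> //; exact: ball_open.
near=> y => v sub.
have /nbhs_ballP[e /= e0 ey] : nbhs y (ball x r) by near: y; exact: nr.
have [|z [w [yz vw reg]]] := limiting_subdiff_approx (e := Num.min e 1) sub.
  by rewrite lt_min e0 ltr01.
move: yz vw; rewrite !lt_min => /andP[yz _] /andP[_ vw].
have zr : ball x r z by apply: ey; rewrite -ball_normE.
have wL := regular_subdiff_bounded fin lip L0 zr reg.
have := ler_normD (v - w) w; have := norm_le_enorm w; rewrite subrK; lra.
Unshelve. all: by end_near. Qed.

(** A diagonal argument: approximate [(x, v)] within [e / 2] by some [(xs t, vs t)], and that pair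
    within [e / 2] by a regular subgradient. *)
Lemma limiting_subdiff_closed {T : Type} {F : set_system T}
    {FF : ProperFilter F} f x v (xs vs : T -> 'rV[R]_n) :
  locally_lipschitz_at f x -> xs @ F --> x -> vs @ F --> v ->
  (\forall t \near F, limiting_subdiff f (xs t) (vs t)) ->
  limiting_subdiff f x v.
Proof.
move=> fx xsx vsv sub; apply: limiting_subdiff_of_approx => // e e0.
have e2 : 0 < e / 2 by rewrite divr_gt0.
move/cvgrPdist_lt : xsx => /(_ _ e2) xsx.
move/cvgrPdist_lt : vsv => /(_ _ e2) vsv.
have [t [xt vt st]] : exists t, [/\ `|x - xs t| < e / 2,
    `|v - vs t| < e / 2 & limiting_subdiff f (xs t) (vs t)].
  by near F => t; exists t; split; near: t.
have [y [w [ty tw reg]]] := limiting_subdiff_approx st e2.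
exists y, w; split=> //.
- by rewrite -(subrK (xs t) x) -addrA (le_lt_trans (ler_normD _ _))//
    [ltRHS](splitr e) ltrD.
- by rewrite -(subrK (vs t) v) -addrA (le_lt_trans (ler_normD _ _))//
    [ltRHS](splitr e) ltrD.
Unshelve. all: by end_near. Qed.

(* The constants of prox-regularity depend on the subgradient at the base point;
   they can be made uniform because the nearby subgradients stay in a compact
   set and accumulate only at subgradients of the base point. *)
Lemma uniform_prox_regular f x :
  locally_lipschitz_at f x -> prox_regular f x ->
  exists e C : R, [/\ 0 < e, 0 <= C &
    forall y z v, `|x - y| < e -> `|x - z| < e -> limiting_subdiff f y v ->
      fine (f y) + dotp v (z - y) - C * enorm (z - y) ^+ 2 <= fine (f z)].
Proof.
move=> fx [_ _ prox]; apply: contrapT => noC.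
(* If no constants work, then radius [1 / (k + 1)] and constant [k] fail for every [k]; [s k]
   records the points [y], [z] and the subgradient [v] of a failure. *)
have /choice[s sP] : forall k : nat,
    exists s : 'rV[R]_n * 'rV[R]_n * 'rV[R]_n,
    [/\ `|x - s.1.1| < k.+1%:R^-1, `|x - s.1.2| < k.+1%:R^-1,
      limiting_subdiff f s.1.1 s.2 &
      fine (f s.1.2) < fine (f s.1.1) + dotp s.2 (s.1.2 - s.1.1)
         - k%:R * enorm (s.1.2 - s.1.1) ^+ 2].
  move=> k; apply: contrapT => nos; apply: noC.
  exists k.+1%:R^-1, k%:R; split=> // y z v xy xz sub.
  by rewrite leNgt; apply/negP => H; apply: nos; exists (y, z, v).
pose ys k := (s k).1.1; pose zs k := (s k).1.2; pose vs k := (s k).2.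
have [U [UU sU]] := @ultraFilterLemma nat \oo _.
have UP : ProperFilter U := ultra_proper.
have cvgx (u : nat -> 'rV[R]_n) :
    (forall k, `|x - u k| < k.+1%:R^-1) -> u @ U --> x.
  move=> ux; apply/cvgrPdist_lt => e e0; apply: sU; near=> k.
  apply: lt_trans (ux k) _; near: k.
  exact: near_infty_natSinv_lt (PosNum e0).
have ysx : ys @ U --> x by apply: cvgx => k; have [] := sP k.
have zsx : zs @ U --> x by apply: cvgx => k; have [] := sP k.
have [M bM] := limiting_subdiff_bounded fx.
have [vb vsv] : exists vb : 'rV[R]_n, vs @ U --> vb.
  apply: (ultra_bounded_cvg (M := M) UU).
  have : \forall k \near U, forall v, limiting_subdiff f (ys k) v -> `|v| <= M.
    exact: ysx _ bM.
  by apply: filterS => k; apply; have [] := sP k.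
have subb : limiting_subdiff f x vb.
  by apply: limiting_subdiff_closed fx ysx vsv _; apply: nearW => k; have [] := sP k.
have [e [r [e0 r0 pr]]] := prox vb subb.
have small (u : nat -> 'rV[R]_n) (l : 'rV[R]_n) : u @ U --> l ->
    \forall k \near U, enorm (u k - l) <= e.
  move=> ul; have ne : 0 < e / n.+1%:R by rewrite divr_gt0.
  move/cvgrPdist_lt : ul => /(_ _ ne); apply: filterS => k H.
  apply: le_trans (enorm_le_norm _) _.
  by rewrite mulrC -ler_pdivlMr// distrC ltW.
have fys : \forall k \near U, fine (f (ys k)) < fine (f x) + e.
  have := cvg_comp _ _ ysx (locally_lipschitz_cvg fx).
  move/cvgrPdist_lt => /(_ _ e0); apply: filterS => k /=.
  by rewrite distrC => /ltr_normlP[]; lra.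
have finU (u : nat -> 'rV[R]_n) : u @ U --> x ->
    \forall k \near U, f (u k) \is a fin_num.
  by move=> /(_ _ (locally_lipschitz_fin_near fx)).
have finx := locally_lipschitz_fin fx.
(* Once [k] reaches [r / 2], a failure with constant [k] contradicts prox-regularity at the limit
   subgradient [vb]. *)
have bigk : \forall k \near U, r / 2 <= k%:R :> R.
  by apply: sU; exact: nbhs_infty_ger.
have [k [ks1 ks2 ks3 ks4 [fy fz rk]]] : exists k, [/\ enorm (ys k - x) <= e,
    enorm (zs k - x) <= e, enorm (vs k - vb) <= e,
    fine (f (ys k)) < fine (f x) + e &
    [/\ f (ys k) \is a fin_num, f (zs k) \is a fin_num & r / 2 <= k%:R]].
  have H1 := small _ _ ysx; have H2 := small _ _ zsx.
  have H3 := small _ _ vsv; have H4 := finU _ ysx; have H5 := finU _ zsx.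
  by near U => k; exists k; split; [| | | |split]; near: k.
have [_ _ subk] := sP k.
have := pr (ys k) (zs k) (vs k) ks1 ks2 _ subk ks3.
rewrite -(fineK fy) -(fineK fz) -(fineK finx) -!EFinD !lee_fin.
move=> /(_ (ltW ks4)) H; apply/negP; rewrite -leNgt.
apply: le_trans H; rewrite addrA lerD2l lerN2 ler_wpM2r// exprn_ge0//.
exact: enorm_ge0.
Unshelve. all: by end_near. Qed.

End Subdifferentials.

(** * Local model of a difference function *)

Section LocalModel.
Context {R : realType} {n : nat}.
Implicit Types (X : set 'rV[R]_n) (g : 'rV[R]_n -> R) (x y z u v : 'rV[R]_n).

Lemma convex_set_segment_closed X :
  convex_set (X : set (convex_lmodType 'rV[R]_n)) -> segment_closed X.
Proof.
move=> cX y z t Xy Xz t0 t1; rewrite addrC.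
by have := cX z y (Itv01 t0 t1) (mem_set Xz) (mem_set Xy); rewrite inE.
Qed.

Lemma derive_gradient g x u :
  differentiable g x -> 'D_u g x = dotp (gradient g x) u.
Proof.
move=> dg; rewrite deriveE// {1}[u]row_sum_delta linear_sum dotpE.
apply: eq_bigr => j _; rewrite linearZ/= -deriveE// mxE mulrC; congr (_ * _).
Qed.

Lemma is_derive_segment g x u (t : R) :
  differentiable g (x + t *: u) ->
  is_derive t 1 (fun s : R => g (x + s *: u))
    (dotp (gradient g (x + t *: u)) u).
Proof.
move=> dg; have quot : (fun h : R => h^-1 *:
      (((fun s : R => g (x + s *: u)) \o shift t) (h *: 1) - g (x + t *: u)))
    = (fun h : R => h^-1 *:
      ((g \o shift (x + t *: u)) (h *: u) - g (x + t *: u))).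
  apply/funext => h /=; congr (_ *: (g _ - _)).
  by rewrite [h *: 1]mulr1 scalerDl addrCA.
apply: DeriveDef.
  by rewrite /derivable quot; exact: diff_derivable.
by rewrite -derive_gradient// /derive quot.
Qed.

Lemma gradient_mean_value g y u :
  (forall x, differentiable g x) ->
  exists2 t : R, 0 <= t <= 1 &
    g (y + u) - g y = dotp (gradient g (y + t *: u)) u.
Proof.
move=> dg.
have [t|t t01 E] := MVT_segment (@ler01 R)
  (fun t (_ : t \in `]0, 1[%R) => is_derive_segment (dg (y + t *: u))).
  apply: continuous_subspaceT => {}t; apply: differentiable_continuous.
  by apply/derivable1_diffP; have := is_derive_segment (dg (y + t *: u)); case.
exists t; first by rewrite in_itv/= in t01.
by move: E; rewrite scale1r scale0r addr0 subr0 mulr1.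
Qed.

(** The mean value point lies on the segment from [y] to [z], hence in [X] and in the ball, where
    the gradient is Lipschitz. The factor [n] in the constant comes from bounding the dot product by
    sup norms. *)
Lemma gradient_quadratic_upper X g x :
  segment_closed X -> X x -> (forall y, differentiable g y) ->
  locally_lipschitz_on X (gradient g) ->
  exists e C : R, [/\ 0 < e, 0 <= C &
    forall y z, X y -> X z -> ball x e y -> ball x e z ->
      g z <= g y + dotp (gradient g y) (z - y) + C * enorm (z - y) ^+ 2].
Proof.
move=> sX Xx dg lip; have [U Ux /lipschitz_bound[L L0 UL]] := lip x Xx.
have /nbhs_ballP[e e0 eU] := Ux.
exists e, (n%:R * L); split=> //; first by rewrite mulr_ge0// ltW.
move=> y z Xy Xz xy xz; have [t /andP[t0 t1]] := gradient_mean_value y (z - y) dg.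
rewrite [y + (z - y)]addrC subrK => E; set w := y + t *: (z - y) in E.
have wE : w = (1 - t) *: y + t *: z.
  by rewrite /w scalerBr scalerBl scale1r addrA addrAC.
have Xw : X w by rewrite wE; exact: sX.
have xw : ball x e w.
  move: xy xz; rewrite -!ball_normE/= => xy xz.
  have -> : x - w = (1 - t) *: (x - y) + t *: (x - z).
    by rewrite wE !scalerBr !scalerBl !scale1r; apply/rowP => j; rewrite !mxE; ring.
  apply: le_lt_trans (ler_normD _ _) _; rewrite !normrZ !ger0_norm ?subr_ge0//.
  have [->|tn0] := eqVneq t 0; first by rewrite mul0r addr0 subr0 mul1r.
  have tp : 0 < t by rewrite lt0r tn0.
  have := ler_wpM2l (_ : 0 <= 1 - t) (ltW xy); rewrite subr_ge0 => /(_ t1).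
  by have : t * `|x - z| < t * e by [rewrite ltr_pM2l]; lra.
have := UL w y (conj (eU _ xw) Xw) (conj (eU _ xy) Xy).
have -> : w - y = t *: (z - y) by rewrite /w addrAC subrr add0r.
rewrite normrZ ger0_norm// => lipw.
have : dotp (gradient g w - gradient g y) (z - y)
    <= n%:R * L * enorm (z - y) ^+ 2.
  apply: le_trans (ler_norm _) _; apply: le_trans (dotp_norm_le _ _) _.
  rewrite expr2 -!mulrA ler_wpM2l// !mulrA ler_pM// ?norm_le_enorm//.
  apply: le_trans lipw _; rewrite ler_pM2l//.
  apply: le_trans (norm_le_enorm _).
  by rewrite -[leRHS]mul1r ler_wpM2r.
rewrite dotpDl dotpNl; lra.
Qed.

(** The quadratic bounds for [g] and [h] are added. Using one [k] for both the radius and the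
    constant makes this an eventual statement, so finitely many indices can be treated at once. *)
Lemma dc_local_model X g (h : 'rV[R]_n -> \bar R) x :
  segment_closed X -> X x -> (forall y, differentiable g y) ->
  locally_lipschitz_on X (gradient g) ->
  locally_lipschitz_at h x -> prox_regular h x ->
  \forall k \near \oo, forall y z v, X y -> X z ->
    ball x k.+1%:R^-1 y -> ball x k.+1%:R^-1 z -> limiting_subdiff h y v ->
    g z - fine (h z) <= g y - fine (h y) + dotp (gradient g y - v) (z - y)
      + k%:R * enorm (z - y) ^+ 2.
Proof.
move=> sX Xx dg lip hx pr.
have [e1 [C1 [e10 C10 up]]] := gradient_quadratic_upper sX Xx dg lip.
have [e2 [C2 [e20 C20 low]]] := uniform_prox_regular hx pr.
near=> k => y z v Xy Xz xy xz sub.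
have ke1 : k.+1%:R^-1 <= e1.
  by apply: ltW; near: k; exact: near_infty_natSinv_lt (PosNum e10).
have ke2 : k.+1%:R^-1 <= e2.
  by apply: ltW; near: k; exact: near_infty_natSinv_lt (PosNum e20).
have kC : C1 + C2 <= k%:R by near: k; exact: nbhs_infty_ger.
have H1 := up y z Xy Xz (le_ball ke1 xy) (le_ball ke1 xz).
have := low y z v; have := le_ball ke2 xy; have := le_ball ke2 xz.
rewrite -ball_normE/= => xz2 xy2 /(_ xy2 xz2 sub) H2.
have := ler_wpM2r (_ : 0 <= enorm (z - y) ^+ 2) kC.
rewrite exprn_ge0 ?enorm_ge0// => /(_ isT) H3.
rewrite dotpDl dotpNl; lra.
Unshelve. all: by end_near. Qed.

End LocalModel.

(** * Real-valued penalty function and model, and descent at the minimizer *)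

Section RealModel.
Context {R : realType} {n : nat} {I : finType}.
Variables (X : set 'rV[R]_n) (g : option I -> 'rV[R]_n -> R)
  (h : option I -> 'rV[R]_n -> \bar R).
Implicit Types (x y d : 'rV[R]_n) (p : R) (v : option I -> 'rV[R]_n)
  (G : 'M[R]_n).

(** Faithful to [phi] on [X], where local Lipschitz continuity makes [h i] finite; [fine] turns an
    infinite value into 0. *)
Definition phi_real (i : option I) x : R := g i x - fine (h i x).

Definition linearization_real x v (i : option I) d : R :=
  phi_real i x + dotp (gradient (g i) x - v i) d.

Definition infeasibility_real x v d : R :=
  \sum_i Num.max (linearization_real x v (Some i) d) 0.

Definition model_real p x v d : R :=
  p^-1 * linearization_real x v None d + infeasibility_real x v d.

Definition penalty_real p x : R :=
  p^-1 * phi_real None x + \sum_i Num.max (phi_real (Some i) x) 0.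

Hypothesis std : standing_assumptions X g h.

Let segX : segment_closed X :=
  convex_set_segment_closed (X_convex std).

Lemma sumE_max0 (F : I -> R) :
  (\sum_i maxe (F i)%:E 0 = (\sum_i Num.max (F i) 0)%:E)%E.
Proof.
by rewrite -sumEFin; apply: eq_bigr => i _; rewrite EFin_max.
Qed.

Lemma phi_realE i x : X x -> phi g h i x = (phi_real i x)%:E.
Proof.
move=> Xx; rewrite /phi /phi_real EFinB fineK//.
exact: locally_lipschitz_fin (h_lipschitz std i Xx).
Qed.

Lemma linearization_realE x v i d :
  X x -> linearization g h x v i d = (linearization_real x v i d)%:E.
Proof. by move=> Xx; rewrite /linearization phi_realE. Qed.

Lemma infeasibility_realE x v d :
  X x -> linearized_infeasibility g h x v d = (infeasibility_real x v d)%:E.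
Proof.
move=> Xx; rewrite /infeasibility_real -sumE_max0.
by apply: eq_bigr => i _; rewrite linearization_realE.
Qed.

Lemma penalty_realE p x : X x -> penalty g h p x = (penalty_real p x)%:E.
Proof.
move=> Xx; rewrite /penalty_real EFinD -sumE_max0 EFinM -phi_realE//.
by congr (_ + _)%E; apply: eq_bigr => i _; rewrite phi_realE.
Qed.

Lemma model_realE p x v y :
  X x -> penalty_model g h p x v y = (model_real p x v (y - x))%:E.
Proof.
by move=> Xx; rewrite /penalty_model linearization_realE// infeasibility_realE.
Qed.

Lemma model_real0 p x v : model_real p x v 0 = penalty_real p x.
Proof.
have lin0 i : linearization_real x v i 0 = phi_real i x.
  by rewrite /linearization_real dotp0r addr0.
rewrite /model_real /penalty_real lin0; congr (_ + _).
by apply: eq_bigr => i _; rewrite lin0.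
Qed.

Lemma model_real_convex p x v :
  0 < p -> convex_fun_on setT (model_real p x v).
Proof.
move=> p0; have aff i : affine_fun (linearization_real x v i).
  by move=> y z t; rewrite /linearization_real dotpDr !dotpZr; ring.
apply: convex_fun_onD.
  apply: affine_convex => y z t; rewrite aff; ring.
apply: convex_fun_on_sum => i; apply: convex_fun_on_max0.
exact/affine_convex/aff.
Qed.

Lemma model_real_scale p x v d t :
  0 < p -> 0 <= t -> t <= 1 ->
  model_real p x v (t *: d) <= (1 - t) * penalty_real p x
    + t * model_real p x v d.
Proof.
move=> p0 t0 t1; rewrite -(model_real0 p x v).
have := @model_real_convex p x v p0 0 d t Logic.I Logic.I t0 t1.
by rewrite scaler0 add0r.
Qed.

Lemma minimizer_real p x v G d :
  X x -> minimizer (subproblem X g h p x v G) d ->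
  X (x + d) /\ forall d', X (x + d') ->
    model_real p x v d + 2^-1 * dotp (d *m G) d
      <= model_real p x v d' + 2^-1 * dotp (d' *m G) d'.
Proof.
move=> Xx dmin.
have sub_in d' : X (x + d') -> subproblem X g h p x v G d'
    = (model_real p x v d' + 2^-1 * dotp (d' *m G) d')%:E.
  move=> Xd; rewrite /subproblem model_realE// /set_indicator asboolT// adde0.
  by rewrite addrAC subrr add0r.
have Xd : X (x + d).
  (* Displacement 0 stays in [X] and has a finite value, whereas leaving [X] costs [+oo]. *)
  apply: contrapT => nX; have := dmin 0.
  rewrite (sub_in 0) ?addr0// /subproblem model_realE// /set_indicator (asboolF nX)/=.
  by rewrite addey.
by split=> // d' Xd'; have := dmin d'; rewrite !sub_in// lee_fin.
Qed.

(* The minimum over the segment from [x] to [x + d] is attained at its end; the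
   factor gained over plain minimality comes from comparing with points close to
   [x + d] instead of [x]. *)
Lemma minimizer_descent p x v G d :
  0 < p -> X x -> 0 <= dotp (d *m G) d ->
  minimizer (subproblem X g h p x v G) d ->
  model_real p x v d + dotp (d *m G) d <= penalty_real p x.
Proof.
move=> p0 Xx Q0 /(minimizer_real Xx)[Xd dmin].
set Q := dotp _ _ in Q0 dmin *; set m := model_real _ _ _ _ in dmin *.
set m0 := penalty_real _ _.
have seg t : 0 <= t -> t <= 1 ->
    m + 2^-1 * Q <= (1 - t) * m0 + t * m + 2^-1 * (t ^+ 2 * Q).
  move=> t0 t1; have Xt : X (x + t *: d).
    have -> : x + t *: d = (1 - t) *: x + t *: (x + d).
      by rewrite scalerBl scale1r scalerDr addrA subrK.
    exact: segX.
  apply: le_trans (dmin _ Xt) _.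
  rewrite -scalemxAl dotpZl dotpZr mulrA -expr2 -/Q lerD2r.
  exact: model_real_scale.
rewrite leNgt; apply/negP => H.
have Qp : 0 < Q by have := seg 0; rewrite lexx ler01 => /(_ isT isT); lra.
have D2 : 0 <= m0 - m by have := seg 0; rewrite lexx ler01 => /(_ isT isT); lra.
(* This [t] minimizes the right-hand side of [seg]. If the claim failed, [t] would be less than 1
   and [seg] would be violated by [(1 - t)^2 * Q / 2]. *)
pose t := (m0 - m) / Q.
have t0 : 0 <= t by rewrite divr_ge0// ltW.
have t1 : t < 1 by rewrite ltr_pdivrMr//; lra.
have tQ : t * Q = m0 - m by rewrite divfK// lt0r_neq0.
have := seg t t0 (ltW t1); have m0E : m0 = m + t * Q by lra.
have : 0 < (1 - t) ^+ 2 * Q by rewrite mulr_gt0// exprn_gt0// subr_gt0.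
rewrite m0E; lra.
Qed.

(** An error [C] in each component costs [C / p] in the objective and at most [C] in each positive
    part. *)
Lemma penalty_real_local_model p x v y (C : R) :
  0 < p -> (forall i, phi_real i y <= linearization_real x v i (y - x) + C) ->
  0 <= C -> penalty_real p y <= model_real p x v (y - x)
     + (p^-1 + #|I|%:R) * C.
Proof.
move=> p0 loc C0; rewrite /penalty_real /model_real mulrDl addrACA.
apply: lerD; first by rewrite -mulrDr ler_pM2l ?invr_gt0.
have -> : #|I|%:R * C = \sum_(i : I) C by rewrite sumr_const mulr_natl.
rewrite -big_split/=; apply: ler_sum => i _.
rewrite ge_max; apply/andP; split; last by rewrite addr_ge0// le_max lexx orbT.
by apply: le_trans (loc _) _; rewrite lerD2r le_max lexx.
Qed.

End RealModel.

(** * Limits of the subproblems *)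

Lemma cvg_max0 {R : realType} {T : Type} {F : set_system T} {FF : Filter F}
    (f : T -> R) (a : R) :
  f @ F --> a -> Num.max (f t) 0 @[t --> F] --> Num.max a 0.
Proof.
move=> fa; rewrite maxr_absE; under eq_fun do rewrite maxr_absE.
apply: cvgMl; apply: cvgD; first by rewrite addr0; under eq_fun do rewrite addr0.
by apply: cvg_norm; rewrite subr0; under eq_fun do rewrite subr0.
Qed.

Section SubproblemLimit.
Context {R : realType} {n : nat} {I : finType}.
Variables (X : set 'rV[R]_n) (g : option I -> 'rV[R]_n -> R)
  (h : option I -> 'rV[R]_n -> \bar R).
Hypothesis std : standing_assumptions X g h.

Let segX : segment_closed X :=
  convex_set_segment_closed (X_convex std).

(* [pi] stands for the limit of [1 / p]: positive when the penalty parameters are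
   bounded, zero otherwise. *)
Definition multiplier_condition (pi : R) (xbar : 'rV[R]_n) : Prop :=
  exists (w : option I -> 'rV[R]_n) (lam : I -> R),
    [/\ forall i, limiting_subdiff (h i) xbar (w i),
        forall i, [/\ 0 <= lam i <= 1,
          phi_real g h (Some i) xbar < 0 -> lam i = 0 &
          0 < phi_real g h (Some i) xbar -> lam i = 1] &
        normal_cone X xbar (- (pi *: (gradient (g None) xbar - w None)
          + \sum_i lam i *: (gradient (g (Some i)) xbar - w (Some i))))].

Context {T : Type} {F : set_system T}.
Variables (x d : T -> 'rV[R]_n) (p : T -> R)
  (v : T -> option I -> 'rV[R]_n) (G : T -> 'M[R]_n) (xbar : 'rV[R]_n).
Hypothesis xX : \forall t \near F, X (x t).
Hypothesis x_cvg : x @ F --> xbar.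
Hypothesis v_sub : \forall t \near F, forall i,
  limiting_subdiff (h i) (x t) (v t i).

Lemma limit_in_X {FF : ProperFilter F} : X xbar.
Proof. by apply: (closed_cvg _ (X_closed std)) x_cvg. Qed.

Lemma cvg_phi_real {FF : ProperFilter F} i :
  phi_real g h i (x t) @[t --> F] --> phi_real g h i xbar.
Proof.
apply: cvgB.
  apply: (@cvg_comp _ _ _ x (g i) F (nbhs xbar) _ x_cvg).
  exact: (differentiable_continuous ((g_C1 std i).1 xbar)).
apply: (@cvg_comp _ _ _ x (fine \o h i) F (nbhs xbar) _ x_cvg).
exact/locally_lipschitz_cvg/(h_lipschitz std i limit_in_X).
Qed.

Lemma cvg_gradient {FF : ProperFilter F} i :
  gradient (g i) (x t) @[t --> F] --> gradient (g i) xbar.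
Proof. exact: cvg_comp _ _ x_cvg ((g_C1 std i).2 xbar). Qed.

(** Subgradients near [xbar] are bounded, so along an ultrafilter those of all indices converge
    simultaneously, and closedness identifies the limits. *)
Lemma subgradients_cvg (FU : UltraFilter F) :
  exists w : option I -> 'rV[R]_n,
    (forall i, v t i @[t --> F] --> w i) /\
    forall i, limiting_subdiff (h i) xbar (w i).
Proof.
have FP : ProperFilter F := @ultra_proper _ _ FU.
have hx i : locally_lipschitz_at (h i) xbar.
  by apply: (h_lipschitz std i); exact: limit_in_X.
have v_sub_i i : \forall t \near F, limiting_subdiff (h i) (x t) (v t i).
  by apply: filterS v_sub => t; apply.
have /choice[w vw] : forall i, exists w : 'rV[R]_n,
    v t i @[t --> F] --> w.
  move=> i; have [M bM] := limiting_subdiff_bounded (hx i).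
  apply: (ultra_bounded_cvg (M := M) FU).
  have bx : \forall t \near F, forall w, limiting_subdiff (h i) (x t) w ->
    `|w| <= M by exact: x_cvg _ bM.
  by apply: filterS2 bx (v_sub_i i) => t; apply.
exists w; split=> // i.
exact: limiting_subdiff_closed (hx i) x_cvg (vw i) (v_sub_i i).
Qed.

Lemma cvg_linearization_real {FF : ProperFilter F} i
    (w dbar : 'rV[R]_n) (e : T -> 'rV[R]_n) :
  v t i @[t --> F] --> w -> e @ F --> dbar ->
  linearization_real g h (x t) (v t) i (e t) @[t --> F]
    --> phi_real g h i xbar + dotp (gradient (g i) xbar - w) dbar.
Proof.
move=> vw ed; apply: cvgD; first exact: cvg_phi_real.
by apply: cvg_dotp ed; apply: cvgB vw; exact: cvg_gradient.
Qed.

Lemma cvg_model_real {FF : ProperFilter F} (w : option I -> 'rV[R]_n)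
    (dbar : 'rV[R]_n) (e : T -> 'rV[R]_n) (pi : R) :
  (p t)^-1 @[t --> F] --> pi ->
  (forall i, v t i @[t --> F] --> w i) -> e @ F --> dbar ->
  model_real g h (p t) (x t) (v t) (e t) @[t --> F]
    --> pi * (phi_real g h None xbar
              + dotp (gradient (g None) xbar - w None) dbar)
        + \sum_i Num.max (phi_real g h (Some i) xbar
              + dotp (gradient (g (Some i)) xbar - w (Some i)) dbar) 0.
Proof.
move=> ppi vw ed; apply: cvgD.
  by apply: cvgM ppi _; exact: cvg_linearization_real.
apply: cvg_sumr => i; apply: cvg_max0.
exact: cvg_linearization_real.
Qed.

(** The minimizer is compared with the displacement [t *: (y - x j)] for [y] in [X]. The matrices
    [G] need not converge: their upper bound leaves a remainder quadratic in [t], which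
    [multipliers_of_segment_minimum] tolerates. *)
Lemma multiplier_condition_of_limit (FU : UltraFilter F) (MG pi : R) :
  (\forall t \near F, forall u,
    0 <= dotp (u *m G t) u <= MG * enorm u ^+ 2) ->
  (\forall t \near F,
    minimizer (subproblem X g h (p t) (x t) (v t) (G t)) (d t)) ->
  (p t)^-1 @[t --> F] --> pi -> d @ F --> (0 : 'rV[R]_n) ->
  multiplier_condition pi xbar.
Proof.
move=> Gb dmin ppi d0; have FP : ProperFilter F := @ultra_proper _ _ FU.
have [w [vw subw]] := subgradients_cvg FU.
have Xxbar : X xbar by exact: limit_in_X.
exists w; pose a i := phi_real g h (Some i) xbar.
pose s i := gradient (g i) xbar - w i.
have [|lam lamP lamN] := @multipliers_of_segment_minimum _ _ _ X xbar (s None)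
  a (fun i => s (Some i)) pi (fun y => 2^-1 * (MG * enorm (y - xbar) ^+ 2))
  segX Xxbar; last by exists lam.
move=> y t Xy t0 t1.
have yx : y - x j @[j --> F] --> y - xbar by apply: cvgB x_cvg; exact: cvg_cst.
have tyx : t *: (y - x j) @[j --> F] --> t *: (y - xbar).
  by apply: cvgZr yx.
have L := cvg_model_real (FF := FP) ppi vw d0.
have U1 := cvg_model_real (FF := FP) ppi vw tyx.
have U2 : 2^-1 * (t ^+ 2 * (MG * enorm (y - x j) ^+ 2)) @[j --> F]
    --> 2^-1 * (t ^+ 2 * (MG * enorm (y - xbar) ^+ 2)).
  do 3 apply: cvgMr; rewrite enorm_sqr; under eq_fun do rewrite enorm_sqr.
  exact: cvg_dotp.
have le_near : \forall j \near F,
    model_real g h (p j) (x j) (v j) (d j)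
    <= model_real g h (p j) (x j) (v j) (t *: (y - x j))
       + 2^-1 * (t ^+ 2 * (MG * enorm (y - x j) ^+ 2)).
  near=> j; have Xj : X (x j) by near: j.
  have Gj : forall u, 0 <= dotp (u *m G j) u <= MG * enorm u ^+ 2 by near: j.
  have dj_min : minimizer (subproblem X g h (p j) (x j) (v j) (G j)) (d j).
    by near: j.
  have [_ minj] := minimizer_real std Xj dj_min.
  have Xt : X (x j + t *: (y - x j)).
    have -> : x j + t *: (y - x j) = (1 - t) *: x j + t *: y.
      by rewrite scalerBr scalerBl scale1r addrA addrAC.
    exact: segX (ltW t0) t1.
  have := minj _ Xt; rewrite -scalemxAl dotpZl dotpZr.
  have /andP[dj _] := Gj (d j); have /andP[_ yj] := Gj (y - x j).
  have := ler_wpM2l (_ : 0 <= t ^+ 2) yj; rewrite exprn_ge0 ?(ltW t0)//.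
  move=> /(_ isT); lra.
(* In the limit the term [pi * phi_real g h None xbar] occurs on both sides and cancels. *)
have := cvgr_to_ge (FF := FP) (cvgB (cvgD U1 U2) L)
  (filterS (fun j H => etrans (subr_ge0 _ _) H) le_near).
rewrite /a /s dotp0r addr0 !dotpZr.
have -> : \sum_i Num.max (phi_real g h (Some i) xbar
    + dotp (gradient (g (Some i)) xbar - w (Some i)) 0) 0
    = \sum_i Num.max (phi_real g h (Some i) xbar) 0.
  by apply: eq_bigr => i _; rewrite dotp0r addr0.
have -> : \sum_i Num.max (phi_real g h (Some i) xbar
    + dotp (gradient (g (Some i)) xbar - w (Some i)) (t *: (y - xbar))) 0
    = \sum_i Num.max (phi_real g h (Some i) xbar
    + t * dotp (gradient (g (Some i)) xbar - w (Some i)) (y - xbar)) 0.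
  by apply: eq_bigr => i _; rewrite dotpZr.
by move=> /(_ _ _ _); lra.
Unshelve. all: by end_near. Qed.

End SubproblemLimit.

(** * Sequences with vanishing steps *)

Section AsymptoticallyRegularSequences.
Context {R : realType} {n : nat}.
Variable x : nat -> 'rV[R]_n.
Implicit Types (y z : 'rV[R]_n) (P : set 'rV[R]_n).

Lemma closed_cluster {T : topologicalType} (F : set_system T) :
  closed (cluster F).
Proof. by rewrite clusterE; apply: closed_bigI => A _; exact: closed_closure. Qed.

Lemma cluster_frequently {T : topologicalType} (u : nat -> T) (y : T)
    (B : set T) (N : nat) :
  cluster (u @ \oo) y -> nbhs y B -> exists2 k, (N <= k)%N & B (u k).
Proof.
move=> cy By; have [|z [[k Nk <-] Bz]] := cy [set u k | k in [set k | (N <= k)%N]] B _ By.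
  by apply: filterS (nbhs_infty_ge N) => k Nk; exists k.
by exists k.
Qed.

Lemma frequently_exit {T : Type} (u : nat -> T) (A : set T) :
  (forall N, exists2 k, (N <= k)%N & A (u k)) ->
  ~ (\forall k \near \oo, A (u k)) ->
  forall N, exists k, [/\ (N <= k)%N, A (u k) & ~ A (u k.+1)].
Proof.
move=> freq nev N; apply: contrapT => noexit; apply: nev.
have [k Nk Ak] := freq N.
exists k => // m /= km; rewrite -(subnKC km).
elim: (m - k)%N => [|j IH]; first by rewrite addn0.
apply: contrapT => nA; apply: noexit; exists (k + j)%N; split=> //.
  by rewrite (leq_trans Nk)// leq_addr.
by rewrite -addnS.
Qed.

(** The ultrafilter is returned with the cluster point so that the successors [x (f k).+1] can be
    followed along it too. *)
Lemma bounded_subsequence_cluster (f : nat -> nat) (M : R) :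
  f @ \oo --> \oo -> (forall k, `|x (f k)| <= M) ->
  exists F : set_system nat, exists2 y, UltraFilter F /\ \oo `<=` F &
    cluster (x @ \oo) y /\ x (f k) @[k --> F] --> y.
Proof.
move=> foo fM; have [F [FU Foo]] := @ultraFilterLemma nat \oo _.
have FP : ProperFilter F := @ultra_proper _ _ FU.
have [|y xfy] := @ultra_bounded_cvg _ _ _ F (x \o f) M FU; first exact: nearW.
exists F, y => //; split=> // A B xA By.
have A_F : \forall k \near F, A (x (f k)) by apply: Foo; exact: foo _ xA.
have B_F : \forall k \near F, B (x (f k)) by exact: xfy _ By.
have [k [Ak Bk]] := filter_ex (filterI A_F B_F).
by exists (x (f k)).
Qed.

Hypothesis step0 : x k.+1 - x k @[k --> \oo] --> (0 : 'rV[R]_n).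

(** At the exit times [f k] the iterate lies in [P] and its successor does not. As steps vanish,
    both tend to the same point along the ultrafilter. *)
Lemma cluster_boundary P (M : R) :
  (forall k, P (x k) -> `|x k| <= M) ->
  (forall N, exists2 k, (N <= k)%N & P (x k)) ->
  ~ (\forall k \near \oo, P (x k)) ->
  exists y, [/\ cluster (x @ \oo) y, closure P y & closure (~` P) y].
Proof.
move=> PM freq nev.
have /choice[f fP] := frequently_exit freq nev.
have foo : f @ \oo --> \oo.
  move=> A [N _ NA]; exists N => // k /= Nk; apply: NA => /=.
  by have [kf _ _] := fP k; exact: leq_trans kf.
have [k|F [y [FU Foo] [cy xfy]]] := @bounded_subsequence_cluster f M foo.
  by apply: PM; have [] := fP k.
have FP : ProperFilter F := @ultra_proper _ _ FU.
have xfSy : x (f k).+1 @[k --> F] --> y.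
  have -> : (fun k => x (f k).+1) =
      (fun k => x (f k).+1 - x (f k) + x (f k)).
    by apply/funext => k; rewrite subrK.
  rewrite -[X in _ --> X]add0r; apply: cvgD xfy.
  move=> A A0; apply: Foo; exact: foo _ (step0 A0).
exists y; split=> // B By.
- have BF : \forall k \near F, B (x (f k)) by exact: xfy _ By.
  have [k Bk] := filter_ex BF.
  by exists (x (f k)); split=> //; have [] := fP k.
- have BF : \forall k \near F, B (x (f k).+1) by exact: xfSy _ By.
  have [k Bk] := filter_ex BF.
  by exists (x (f k).+1); split=> //; have [] := fP k.
Qed.

Lemma bounded_cluster_set :
  bounded_fun x ->
  [/\ cluster (x @ \oo) !=set0, closed (cluster (x @ \oo))
    & connected (cluster (x @ \oo))].
Proof.
move=> [M0 [_ xM0]]; pose M := `|M0| + 1.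
have xM k : `|x k| <= M.
  by apply: (xM0 M) => //; rewrite (le_lt_trans (ler_norm _))// ltrDl.
split; [|exact: closed_cluster|].
- have [||F [y _ [cy _]]] := @bounded_subsequence_cluster id M.
  + exact: cvg_id.
  + exact: xM.
  + by exists y.
- move=> B [b Bb] [W oW BW] [Z cZ BZ]; apply: contrapT => BC.
  set C := cluster _ in BW BZ BC.
  have cC : closed C by exact: closed_cluster.
  have cB : closed B by rewrite BZ; exact: closedI.
  have cB2 : closed (C `&` ~` W) by apply: closedI => //; exact: open_closedC.
  (* [B] and the rest of [C] are disjoint closed sets, so normality separates them by open sets [U]
     and [V]. The sequence visits both infinitely often, hence has a cluster point on the boundary
     of [U], which can lie neither in [B] nor in the rest of [C]. *)
  have [|U [V [oU oV BU B2V UV]]] := (@normal_openP R _).1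
    (@pseudometric_normal R 'rV[R]_n) _ _ cB cB2.
    by rewrite BW setIACA setICr setI0.
  have CB y : C y -> ~ B y -> V y.
    by move=> Cy nBy; apply: B2V; split=> // Oy; apply: nBy; rewrite BW.
  have UnV y : U y -> V y -> False.
    by move=> Uy Vy; have : (U `&` V) y by []; rewrite UV.
  have nbhsU y : U y -> nbhs y U by move=> Uy; exact: open_nbhs_nbhs.
  have nbhsV y : V y -> nbhs y V by move=> Vy; exact: open_nbhs_nbhs.
  have BsubC : B `<=` C by move=> y; rewrite BW => -[].
  have [a [Ca nBa]] : exists a, C a /\ ~ B a.
    apply: contrapT => noa; apply: BC; apply/seteqP; split=> // y Cy.
    by apply: contrapT => nBy; apply: noa; exists y.
  have [| | |y [Cy clU clnU]] := @cluster_boundary U M.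
  + by move=> k _; exact: xM.
  + move=> N; have [k Nk Uk] := cluster_frequently N (BsubC _ Bb) (nbhsU _ (BU _ Bb)).
    by exists k.
  + move=> [N _ NU]; have [k Nk Vk] := cluster_frequently N Ca (nbhsV _ (CB _ Ca nBa)).
    exact: UnV (NU k Nk) Vk.
  + have [By|nBy] := pselect (B y).
      by have [z []] := clnU _ (nbhsU _ (BU _ By)).
    have [z [Uz Vz]] := clU _ (nbhsV _ (CB _ Cy nBy)).
    exact: UnV Uz Vz.
Qed.

Lemma isolated_cluster_cvg y :
  isolated (cluster (x @ \oo)) y -> x @ \oo --> y.
Proof.
move=> [/set_mem cy [V Vy VC]]; apply/cvgrPdist_lt => e e0.
have /nbhs_ballP[r /= r0 rV] := Vy.
(* The bound [r / 2] keeps the closure of the ball inside [V], so a cluster point on its boundary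
   would have to be the centre [y]. *)
pose s := Num.min e (r / 2).
have s0 : 0 < s by rewrite lt_min e0 divr_gt0.
apply: contrapT => nev.
have [| | |z [cz clz clnz]] := @cluster_boundary (ball y s) (`|y| + s).
- move=> k; rewrite -ball_normE/= distrC => yk.
  by have := ler_normD (x k - y) y; rewrite subrK; lra.
- by move=> N; apply: (cluster_frequently N cy); exact: nbhsx_ballx.
- move=> ev; apply: nev; apply: filterS ev => k; rewrite -ball_normE/= => yk.
  by apply: lt_le_trans yk _; rewrite ge_min lexx.
have yz : z = y.
  have : (V `&` cluster (x @ \oo)) z.
    split=> //; apply: rV.
    have [w [yw zw]] := clz _ (nbhsx_ballx z (r / 2) (divr_gt0 r0 (ltr0n _ 2))).
    rewrite (splitr r); apply: ball_triangle (ball_sym zw).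
    by apply: le_ball yw; rewrite ge_min lexx orbT.
  by rewrite VC.
have := clnz (ball y s); rewrite yz => /(_ (nbhsx_ballx _ _ s0)).
by move=> [w []].
Qed.

End AsymptoticallyRegularSequences.

(** * Runs of the algorithm *)

Section StationarityFromMultipliers.
Context {R : realType} {n : nat} {I : finType}.
Variables (X : set 'rV[R]_n) (g : option I -> 'rV[R]_n -> R)
  (h : option I -> 'rV[R]_n -> \bar R).
Hypothesis std : standing_assumptions X g h.
Implicit Types (xbar : 'rV[R]_n).

Lemma feasible_real xbar :
  X xbar -> feasible X g h xbar <-> forall i, phi_real g h (Some i) xbar <= 0.
Proof.
move=> Xx; split=> [[_ f] i|f].
  by have := f i; rewrite (phi_realE std)// lee_fin.
by split=> // i; rewrite (phi_realE std)// lee_fin.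
Qed.

(** Dividing by [pi] normalizes the objective coefficient to 1. Complementarity follows because at a
    feasible point each constraint is either zero or negative, and then has multiplier 0. *)
Lemma stationary_of_multiplier_condition (pi : R) xbar :
  0 < pi -> feasible X g h xbar -> multiplier_condition X g h pi xbar ->
  stationary_point X g h xbar.
Proof.
move=> pi0 feas [w [lam [subw lamP [Xx lamN]]]]; split=> //.
have feasr := (feasible_real Xx).1 feas.
have piV : 0 < pi^-1 by rewrite invr_gt0.
exists (fun i => pi^-1 * lam i); split.
- by move=> i; rewrite mulr_ge0 ?(ltW piV)//; have [/andP[]] := lamP i.
- set N := - (_ + _) in lamN; exists w, (pi^-1 *: N); split=> //.
    by split=> // y Xy; rewrite dotpZl mulr_ge0_le0 ?(ltW piV)// lamN.
  rewrite /N scalerN scalerDr scalerA mulVf ?(lt0r_neq0 pi0)// scale1r.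
  rewrite scaler_sumr opprD addrACA subrr add0r; apply/esym/eqP.
  by rewrite subr_eq0; apply/eqP/eq_bigr => i _; rewrite scalerA.
- move=> i; rewrite (phi_realE std)// -EFinM; congr EFin.
  have [_ neg _] := lamP i; have := feasr i.
  by rewrite le_eqVlt => /orP[/eqP->|/neg->]; rewrite ?mulr0 ?mul0r.
Qed.

Lemma violation_of_multiplier_condition xbar :
  multiplier_condition X g h 0 xbar -> violation_stationary_point X g h xbar.
Proof.
move=> [w [lam [subw lamP [Xx lamN]]]]; exists lam; split.
- by move=> i; have [] := lamP i.
- by move=> i; rewrite (phi_realE std)// lte_fin; have [] := lamP i.
- by move=> i; rewrite (phi_realE std)// lte_fin; have [] := lamP i.
exists (fun i => w (Some i)); exists (- (\sum_i lam i *: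
  (gradient (g (Some i)) xbar - w (Some i)))); split=> [i||]; first exact: subw.
  by split=> // y Xy; have := lamN y Xy; rewrite scale0r add0r.
by rewrite subrr.
Qed.

End StationarityFromMultipliers.

Section Run.
Context {R : realType} {n : nat} {I : finType}.
Variables (X : set 'rV[R]_n) (g : option I -> 'rV[R]_n -> R)
  (h : option I -> 'rV[R]_n -> \bar R).
Variables (alpha MG beta sigma rho c : R) (x0 : 'rV[R]_n) (p0 : R).
Variables (x : nat -> 'rV[R]_n) (p : nat -> R)
  (v : nat -> option I -> 'rV[R]_n) (G : nat -> 'M[R]_n)
  (d : nat -> 'rV[R]_n) (q : nat -> nat).
Hypothesis std : standing_assumptions X g h.
Hypothesis run : cdp_esqm_run X g h alpha MG beta sigma rho c x0 p0 x p v G d q.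

Let segX : segment_closed X :=
  convex_set_segment_closed (X_convex std).

Notation reached := (reached g h x d).
Notation stop := (stop g h x d).

Lemma reachedW k : reached k.+1 -> reached k.
Proof. by move=> r j jk; apply: r; rewrite ltnS ltnW. Qed.

Lemma beta_gt0 : 0 < beta.
Proof. by have /andP[] := beta_in01 run. Qed.

Lemma step_size_gt0 j : 0 < beta ^+ j.
Proof. by rewrite exprn_gt0// beta_gt0. Qed.

Lemma step_size_le1 j : beta ^+ j <= 1.
Proof.
rewrite exprn_ile1//; first exact: ltW beta_gt0.
by have /andP[_ /ltW] := beta_in01 run.
Qed.

Lemma dotp_G_ge0 k : reached k -> forall u,
  0 <= dotp (u *m G k) u <= MG * enorm u ^+ 2.
Proof.
move=> rk u; have /andP[lo ->] := G_bounds run rk u; rewrite andbT.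
by rewrite (le_trans _ lo)// mulr_ge0 ?exprn_ge0 ?enorm_ge0// (ltW (alpha_gt0 run)).
Qed.

Lemma minimizer_d k : reached k ->
  minimizer (subproblem X g h (p k) (x k) (v k) (G k)) (d k).
Proof. by move=> /(d_minimizer run)[]. Qed.

Lemma trial_in_X (y : 'rV[R]_n) k t :
  X (x k) -> X (x k + y) -> 0 <= t -> t <= 1 -> X (x k + t *: y).
Proof.
move=> Xx Xy t0 t1.
have -> : x k + t *: y = (1 - t) *: x k + t *: (x k + y).
  by rewrite scalerBl scale1r scalerDr addrA subrK.
exact: segX.
Qed.

Lemma reached_in_X k : reached k -> X (x k).
Proof.
elim: k => [_|k IH rk]; first by rewrite (x_init run); exact: x0_in_X run.
have Xk := IH (reachedW rk); rewrite (x_update run rk).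
have [Xd _] := minimizer_real std Xk (minimizer_d (reachedW rk)).
by apply: trial_in_X; rewrite ?step_size_le1 ?(ltW (step_size_gt0 _)).
Qed.

Lemma p_le_next k : reached k.+1 -> p k <= p k.+1.
Proof.
move=> rk; rewrite (p_update run rk); case: ifP => // _.
by rewrite lerDl (ltW (rho_gt0 run)).
Qed.

Lemma p0_le k : reached k -> p0 <= p k.
Proof.
elim: k => [_|k IH rk]; first by rewrite (p_init run).
exact: le_trans (IH (reachedW rk)) (p_le_next rk).
Qed.

Lemma p_gt0 k : reached k -> 0 < p k.
Proof. by move=> /p0_le; exact: lt_le_trans (p0_gt0 run). Qed.

(** The limit result is applied to constant families along a principal ultrafilter, since the
    displacement is exactly 0. *)
Lemma stop_stationary k : reached k -> stop k -> stationary_point X g h (x k).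
Proof.
move=> rk [d0 feas]; have Xk := reached_in_X rk.
apply: (@stationary_of_multiplier_condition _ _ _ _ _ _ std (p k)^-1).
- by rewrite invr_gt0 p_gt0.
- by split.
- apply: (@multiplier_condition_of_limit _ _ _ _ _ _ std nat
    (principal_filter 0%N) (fun=> x k) (fun=> d k) (fun=> p k) (fun=> v k)
    (fun=> G k) (x k) _ _ _ _ MG).
  + exact: nearW.
  + exact: cvg_cst.
  + by apply: nearW => _ i; exact: (v_subgradient run rk i).
  + exact: principal_filter_ultra.
  + by apply: nearW => _; exact: dotp_G_ge0.
  + by apply: nearW => _; exact: minimizer_d.
  + exact: cvg_cst.
  + by rewrite d0; exact: cvg_cst.
Qed.

Hypothesis nostop : forall k, ~ stop k.

Lemma always_reached k : reached k.
Proof. by move=> j _; exact: nostop. Qed.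

Let Xx k : X (x k) := reached_in_X (@always_reached k).
Let pp k : 0 < p k := p_gt0 (@always_reached k).

Lemma x_d_in_X k : X (x k + d k).
Proof.
by have [] := minimizer_real std (Xx k) (minimizer_d (@always_reached k)).
Qed.

Lemma trial_step_in_X k j : X (x k + beta ^+ j *: d k).
Proof.
apply: trial_in_X; rewrite ?step_size_le1 ?(ltW (step_size_gt0 _))//.
exact: x_d_in_X.
Qed.

Lemma sufficient_decrease_real k j :
  sufficient_decrease g h alpha beta sigma x p v d k j <->
  penalty_real g h (p k) (x k + beta ^+ j *: d k)
    <= model_real g h (p k) (x k) (v k) (beta ^+ j *: d k)
       + (1 - sigma) * alpha * beta ^+ j * enorm (d k) ^+ 2.
Proof.
rewrite /sufficient_decrease (penalty_realE std); last exact: trial_step_in_X.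
by rewrite (model_realE std)// addrAC subrr add0r -EFinD lee_fin.
Qed.

Lemma model_descent k :
  model_real g h (p k) (x k) (v k) (d k) + alpha * enorm (d k) ^+ 2
    <= penalty_real g h (p k) (x k).
Proof.
have rk := @always_reached k.
have /andP[Q0 _] := dotp_G_ge0 rk (d k).
apply: le_trans (minimizer_descent std (pp k) (Xx k) Q0 (minimizer_d rk)).
by rewrite lerD2l; have /andP[] := G_bounds run rk (d k).
Qed.

Lemma penalty_descent k :
  penalty_real g h (p k) (x k.+1)
    <= penalty_real g h (p k) (x k)
       - sigma * alpha * (beta ^+ q k * enorm (d k) ^+ 2).
Proof.
have rk := @always_reached k.+1; rewrite (x_update run rk).
have [/sufficient_decrease_real dec _] := q_smallest run rk.
apply: le_trans dec _.
have := model_real_scale g h (x k) (v k) (d k) (pp k)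
  (ltW (step_size_gt0 (q k))) (step_size_le1 (q k)).
have := ler_wpM2l (ltW (step_size_gt0 (q k))) (model_descent k).
lra.
Qed.

(* Subtracting the lower bound [m] of the objective makes the potential monotone
   although the penalty parameter changes from one iteration to the next. *)
Definition shifted_penalty (m : R) k : R :=
  (p k)^-1 * (phi_real g h None (x k) - m)
    + \sum_i Num.max (phi_real g h (Some i) (x k)) 0.

Lemma shifted_penalty_descent m k :
  (forall y, X y -> m <= phi_real g h None y) ->
  sigma * alpha * (beta ^+ q k * enorm (d k) ^+ 2)
    <= shifted_penalty m k - shifted_penalty m k.+1.
Proof.
move=> low; have := penalty_descent k; rewrite /penalty_real /shifted_penalty.
have : (p k.+1)^-1 * (phi_real g h None (x k.+1) - m)
    <= (p k)^-1 * (phi_real g h None (x k.+1) - m).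
  rewrite ler_wpM2r ?subr_ge0 ?low// lef_pV2 ?posrE//.
  exact: p_le_next (@always_reached k.+1).
lra.
Qed.

(** The shifted penalty is nonincreasing and nonnegative, so it converges, and its consecutive
    differences, which dominate these terms, tend to 0. *)
Lemma decrease_cvg0 : beta ^+ q k * enorm (d k) ^+ 2 @[k --> \oo] --> (0 : R).
Proof.
have [m lowE] := phi0_bounded_below std.
have low y : X y -> m <= phi_real g h None y.
  by move=> Xy; have := lowE y Xy; rewrite (phi_realE std)// lee_fin.
have sa : 0 < sigma * alpha.
  by rewrite mulr_gt0// ?(alpha_gt0 run)//; have /andP[] := sigma_in01 run.
have dec0 k : 0 <= beta ^+ q k * enorm (d k) ^+ 2.
  by rewrite mulr_ge0 ?exprn_ge0 ?enorm_ge0// (ltW beta_gt0).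
have cvgE : cvgn (shifted_penalty m).
  apply: nonincreasing_is_cvgn.
    apply/nonincreasing_seqP => k; rewrite -subr_ge0.
    by apply: le_trans (shifted_penalty_descent k low); rewrite mulr_ge0// ltW.
  exists 0 => _ [k _ <-]; rewrite addr_ge0//.
    by rewrite mulr_ge0 ?invr_ge0 ?(ltW (pp k))// subr_ge0 low.
  by apply: sumr_ge0 => i _; rewrite le_max lexx orbT.
have diff0 : (sigma * alpha)^-1 *
    (shifted_penalty m k - shifted_penalty m k.+1) @[k --> \oo] --> (0 : R).
  rewrite -(mulr0 (sigma * alpha)^-1); apply: cvgMr.
  rewrite -(subrr (limn (shifted_penalty m))); apply: cvgB => //.
  by rewrite (cvg_shiftS (shifted_penalty m)).
apply: (squeeze_cvgr _ (cvg_cst 0) diff0); apply: nearW => k.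
by rewrite dec0/= [leRHS]mulrC ler_pdivlMr// mulrC shifted_penalty_descent.
Qed.

Lemma step_cvg0 : x k.+1 - x k @[k --> \oo] --> (0 : 'rV[R]_n).
Proof.
apply: cvg_enorm0.
have sqrt0 : Num.sqrt (beta ^+ q k * enorm (d k) ^+ 2) @[k --> \oo] --> (0 : R).
  rewrite -sqrtr0; apply: (@cvg_comp _ _ _ _ _ _ _ _ decrease_cvg0).
  exact: sqrt_continuous.
apply: (squeeze_cvgr _ (cvg_cst 0) sqrt0); apply: nearW => k.
rewrite enorm_ge0/= (x_update run (@always_reached k.+1)) addrAC subrr add0r.
rewrite -[leLHS]ger0_norm ?enorm_ge0// -sqrtr_sqr ler_wsqrtr//.
rewrite enormZ exprMn real_normK ?num_real// ler_wpM2r ?exprn_ge0 ?enorm_ge0//.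
by rewrite expr2 ger_pMl ?step_size_gt0// step_size_le1.
Qed.

Let p_nondecreasing : nondecreasing_seq p.
Proof.
by apply/nondecreasing_seqP => k; exact: (p_le_next (@always_reached k.+1)).
Qed.

(** A bounded nondecreasing [p] converges, while each of its increments is 0 or [rho]; so eventually
    the update test fails. *)
Lemma bounded_penalty_infeasibility :
  bounded_fun p -> \forall k \near \oo,
    infeasibility_real g h (x k) (v k) (d k) < c * enorm (d k).
Proof.
move=> [M [_ pM]].
have cp : cvgn p.
  apply: nondecreasing_is_cvgn => //; exists (`|M| + 1) => _ [k _ <-].
  rewrite (le_trans (ler_norm _))//.
  by apply: (pM (`|M| + 1)) => //; rewrite (le_lt_trans (ler_norm _))// ltrDl.
have diff0 : p k.+1 - p k @[k --> \oo] --> (0 : R).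
  by rewrite -(subrr (limn p)); apply: cvgB => //; rewrite (cvg_shiftS p).
have r0 : `|0 : R| < rho by rewrite normr0 (rho_gt0 run).
apply: filterS (cvgr_norm_lt _ diff0 _ r0) => k.
rewrite (p_update run (@always_reached k.+1)) (infeasibility_realE std)//.
rewrite lee_fin.
case: (leP (c * enorm (d k)) (infeasibility_real g h (x k) (v k) (d k))) => // _.
by rewrite addrAC subrr add0r gtr0_norm ?(rho_gt0 run)// ltxx.
Qed.

Lemma penalty_inv_cvg : cvgn (fun k => (p k)^-1).
Proof.
apply: nonincreasing_is_cvgn.
  by move=> j k jk; rewrite lef_pV2 ?posrE//; exact: p_nondecreasing.
by exists 0 => _ [k _ <-]; rewrite invr_ge0 ltW.
Qed.

Lemma bounded_penalty_inv_lim :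
  bounded_fun p -> 0 < limn (fun k => (p k)^-1).
Proof.
move=> [M [_ pM]]; pose M1 := `|M| + 1.
have M10 : 0 < M1 by rewrite ltr_wpDl.
apply: (@lt_le_trans _ _ M1^-1); first by rewrite invr_gt0.
apply: limr_ge; first exact: penalty_inv_cvg.
apply: nearW => k; rewrite lef_pV2 ?posrE// (le_trans (ler_norm _))//.
by apply: (pM M1) => //; rewrite (le_lt_trans (ler_norm _))// ltrDl.
Qed.

Lemma unbounded_penalty_inv_cvg0 :
  ~ bounded_fun p -> (p k)^-1 @[k --> \oo] --> (0 : R).
Proof.
move=> nb; apply/cvgrPdist_le => e e0.
have [N pN] : exists N, e^-1 < p N.
  apply: contrapT => noN; apply: nb; exists e^-1; split; first exact: num_real.
  move=> M eM k _ /=; rewrite gtr0_norm//; apply: le_trans (ltW eM).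
  by rewrite leNgt; apply/negP => pk; apply: noN; exists k.
exists N => // k /= Nk; rewrite sub0r normrN gtr0_norm ?invr_gt0//.
rewrite -[e]invrK lef_pV2 ?posrE ?invr_gt0//.
exact: le_trans (ltW pN) (p_nondecreasing Nk).
Qed.

Let pV_le k : (p k)^-1 <= p0^-1.
Proof.
by rewrite lef_pV2 ?posrE ?(p0_gt0 run)//; exact: (p0_le (@always_reached k)).
Qed.

(** Bounds the total weight [(p k)^-1 + #|I|] of the components in the penalty function, uniformly
    in [k]. *)
Let weight : R := p0^-1 + #|I|%:R.

Let weight_gt0 : 0 < weight.
Proof. by rewrite ltr_wpDr// invr_gt0 (p0_gt0 run). Qed.

(** The model decrease is at least [alpha |d k|^2] and at most linear in [|d k|], because the slopes
    of the linearizations are bounded; then divide by [|d k|]. *)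
Lemma direction_bound k (M : R) :
  (forall i, `|gradient (g i) (x k) - v k i| <= M) ->
  alpha * enorm (d k) <= weight * (n%:R * M).
Proof.
move=> sM; have M0 : 0 <= M by apply: le_trans (sM None).
have [d0|dn0] := eqVneq (enorm (d k)) 0.
  by rewrite d0 mulr0 !mulr_ge0// ltW.
have d0 : 0 < enorm (d k) by rewrite lt0r dn0 enorm_ge0.
rewrite -(ler_pM2r d0) -mulrA -expr2.
pose D := n%:R * M * enorm (d k).
have D0 : 0 <= D by rewrite /D !mulr_ge0// ltW.
have sD i : `|dotp (gradient (g i) (x k) - v k i) (d k)| <= D.
  apply: le_trans (dotp_norm_le _ _) _; rewrite /D.
  by rewrite ler_pM ?norm_le_enorm// ?mulr_ge0// ler_wpM2l.
rewrite -mulrA -/D.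
have := model_descent k; rewrite /model_real /penalty_real.
have : \sum_i Num.max (phi_real g h (Some i) (x k)) 0
    <= infeasibility_real g h (x k) (v k) (d k) + #|I|%:R * D.
  have -> : #|I|%:R * D = \sum_(i : I) D by rewrite sumr_const mulr_natl.
  rewrite -big_split/=; apply: ler_sum => i _; rewrite /linearization_real.
  have /ler_normlP[lo _] := sD (Some i).
  set a := phi_real _ _ _ _; set b := dotp _ _ in lo *.
  have [ab|ab] := leP (a + b) 0; have [a0|a0] := leP a 0; lra.
have : (p k)^-1 * phi_real g h None (x k)
    <= (p k)^-1 * linearization_real g h (x k) (v k) None (d k) + p0^-1 * D.
  have /ler_normlP[lo _] := sD None.
  have pV0 : 0 < (p k)^-1 by rewrite invr_gt0.
  have H1 : (p k)^-1 * D <= p0^-1 * D by rewrite ler_wpM2r.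
  have H2 := ler_wpM2l (ltW pV0) lo.
  rewrite /linearization_real; lra.
rewrite /weight; lra.
Qed.

(** * Step sizes, directions and stationarity along a convergent ultrafilter *)

Variables (F : set_system nat) (xbar : 'rV[R]_n).
Hypothesis FU : UltraFilter F.
Hypothesis F_oo : \oo `<=` F.
Hypothesis x_cvg : x @ F --> xbar.

Let FP : ProperFilter F := @ultra_proper _ _ FU.

Let Xxbar : X xbar.
Proof. by apply: (limit_in_X std _ x_cvg); exact: nearW. Qed.

Lemma direction_bounded :
  exists2 D : R, 0 <= D & \forall k \near F, enorm (d k) <= D.
Proof.
have [] := @subgradients_cvg _ _ _ X g h std nat F x v xbar _ x_cvg _ FU.
- exact: nearW.
- by apply: nearW => k i; exact: (v_subgradient run (@always_reached k) i).
move=> w [vw _].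
have sw i : gradient (g i) (x k) - v k i @[k --> F] --> gradient (g i) xbar - w i.
  by apply: cvgB (vw i); exact: (cvg_gradient std).
pose M := \sum_i (`|gradient (g i) xbar - w i| + 1).
have sM i : \forall k \near F, `|gradient (g i) (x k) - v k i| <= M.
  have H : `|gradient (g i) xbar - w i| < `|gradient (g i) xbar - w i| + 1.
    by rewrite ltrDl.
  apply: filterS (cvgr_norm_lt _ (sw i) _ H) => k kM; apply: le_trans (ltW kM) _.
  rewrite /M (bigD1 i)//= lerDl.
  by apply: sumr_ge0 => j _; rewrite addr_ge0.
have a0 := alpha_gt0 run.
have M0 : 0 <= M by apply: sumr_ge0 => j _; rewrite addr_ge0.
exists (weight * (n%:R * M) / alpha).
  by rewrite divr_ge0 ?(ltW a0)// !mulr_ge0// ltW.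
near=> k; rewrite ler_pdivlMr// mulrC; apply: direction_bound.
by near: k; exact: filter_forall.
Unshelve. all: by end_near. Qed.

(** Every trial step of size at most [theta0] is accepted. So either the first trial succeeds, or
    the last rejected one exceeds [theta0] and the accepted one exceeds [beta * theta0]. *)
Lemma step_size_bounded_below :
  exists2 theta : R, 0 < theta & \forall k \near F, theta <= beta ^+ q k.
Proof.
have [D D0 dD] := direction_bounded.
have loc : \forall m \near \oo, forall i y z w, X y -> X z ->
    ball xbar m.+1%:R^-1 y -> ball xbar m.+1%:R^-1 z ->
    limiting_subdiff (h i) y w ->
    g i z - fine (h i z) <= g i y - fine (h i y)
      + dotp (gradient (g i) y - w) (z - y) + m%:R * enorm (z - y) ^+ 2.
  apply: filter_forall => i; apply: dc_local_model => //.
  - exact: (g_C1 std i).1.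
  - exact: g_grad_lipschitz std i.
  - by apply: (h_lipschitz std).
  - by apply: (h_prox_regular std).
have [m locm] := filter_ex loc.
pose del : R := m.+1%:R^-1 / 2.
have del0 : 0 < del by rewrite divr_gt0.
have as0 : 0 < (1 - sigma) * alpha.
  rewrite mulr_gt0 ?(alpha_gt0 run)// subr_gt0.
  by have /andP[] := sigma_in01 run.
have b0 := beta_gt0.
(* The first bound keeps the trial point in the ball where the local model holds; the second makes
   the quadratic error at most the slack of the line search. Adding 1 keeps the denominators
   positive. *)
pose theta0 : R := Num.min (del / (D + 1))
  ((1 - sigma) * alpha / (weight * m%:R + 1)).
have D1 : 0 < D + 1 by rewrite ltr_wpDl.
have W1 : 0 < weight * m%:R + 1 by rewrite ltr_wpDl// mulr_ge0// ltW.
have theta00 : 0 < theta0 by rewrite lt_min !divr_gt0.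
have accept : \forall k \near F, forall j, beta ^+ j <= theta0 ->
    sufficient_decrease g h alpha beta sigma x p v d k j.
  near=> k => j jth; apply/sufficient_decrease_real.
  set t := beta ^+ j in jth *.
  have t0 : 0 < t := step_size_gt0 j.
  have kD : enorm (d k) <= D by near: k.
  have xk : ball xbar del (x k).
    by near: k; apply: x_cvg; exact: nbhsx_ballx.
  have tD : t * enorm (d k) < del.
    have H : t * (D + 1) <= del.
      by rewrite -ler_pdivlMr// (le_trans jth)// ge_min lexx.
    have H2 : t * enorm (d k) <= t * D by rewrite ler_pM2l.
    by move: H H2 t0; lra.
  have yX : X (x k + t *: d k) := trial_step_in_X k j.
  have tdE : x k + t *: d k - x k = t *: d k by rewrite addrAC subrr add0r.
  have xk2 : ball xbar m.+1%:R^-1 (x k).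
    by apply: le_ball xk; rewrite ler_pdivrMr// ler_pMr ?invr_gt0// ler1n.
  have yk : ball xbar m.+1%:R^-1 (x k + t *: d k).
    move: xk; rewrite -!ball_normE/= => xk; rewrite opprD addrA.
    apply: le_lt_trans (ler_normB _ _) _.
    rewrite [ltRHS](splitr m.+1%:R^-1) ltrD// normrZ (gtr0_norm t0).
    by apply: le_lt_trans tD; rewrite ler_pM2l// norm_le_enorm.
  have C0 : 0 <= m%:R * enorm (t *: d k) ^+ 2.
    by rewrite mulr_ge0// exprn_ge0// enorm_ge0.
  have := @penalty_real_local_model _ _ _ g h (p k) (x k) (v k)
    (x k + t *: d k) _ (pp k) _ C0.
  rewrite tdE => H; apply: le_trans (H _) _.
    move=> i; have := locm i _ _ _ (@Xx k) yX xk2 yk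
      (v_subgradient run (@always_reached k) i).
    by rewrite tdE.
  rewrite lerD2l enormZ (gtr0_norm t0) exprMn.
  have Wm : weight * m%:R * t <= (1 - sigma) * alpha.
    apply: (@le_trans _ _ ((weight * m%:R + 1) * t)).
      by rewrite ler_pM2r// lerDl.
    by rewrite mulrC -ler_pdivlMr// (le_trans jth)// ge_min lexx orbT.
  apply: (@le_trans _ _ (weight * (m%:R * (t ^+ 2 * enorm (d k) ^+ 2)))).
    apply: ler_wpM2r; last by rewrite /weight lerD2r.
    by rewrite -exprMn mulr_ge0// exprn_ge0// mulr_ge0 ?enorm_ge0// ltW.
  have Q0 : 0 <= t * enorm (d k) ^+ 2.
    by apply: mulr_ge0; rewrite ?(ltW t0) ?sqr_ge0.
  have := ler_wpM2r Q0 Wm; lra.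
exists (Num.min 1 (beta * theta0)).
  by rewrite lt_min ltr01 mulr_gt0.
near=> k; have acc : forall j, beta ^+ j <= theta0 ->
    sufficient_decrease g h alpha beta sigma x p v d k j by near: k.
have [_ qmin] := q_smallest run (@always_reached k.+1).
case: (q k) qmin => [_|j qmin]; first by rewrite expr0 ge_min lexx.
rewrite ge_min exprS ler_pM2l//; apply/orP; right.
by rewrite leNgt; apply/negP => /ltW/acc; exact: qmin.
Unshelve. all: by end_near. Qed.

Lemma direction_cvg0 : d @ F --> (0 : 'rV[R]_n).
Proof.
have [theta th0 thq] := step_size_bounded_below.
apply: cvg_enorm0.
have dec0 : Num.sqrt (theta^-1 * (beta ^+ q k * enorm (d k) ^+ 2)) @[k --> F]
    --> (0 : R).
  rewrite -[X in _ --> X]sqrtr0 -(mulr0 theta^-1).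
  apply: (@cvg_comp _ _ _ _ Num.sqrt _ (nbhs _)); last exact: sqrt_continuous.
  by apply: cvgMr; exact: cvg_trans (cvg_app _ F_oo) decrease_cvg0.
apply: (squeeze_cvgr _ (cvg_cst 0) dec0).
near=> k; rewrite enorm_ge0/= -[leLHS]ger0_norm ?enorm_ge0// -sqrtr_sqr.
rewrite ler_wsqrtr// mulrA ler_peMl ?exprn_ge0 ?enorm_ge0//.
by rewrite mulrC ler_pdivlMr// mul1r; near: k.
Unshelve. all: by end_near. Qed.

Lemma limit_multiplier_condition (pi : R) :
  (p k)^-1 @[k --> F] --> pi -> multiplier_condition X g h pi xbar.
Proof.
move=> ppi; apply: (@multiplier_condition_of_limit _ _ _ _ _ _ std nat
    F x d p v G xbar _ x_cvg _ FU MG) => //.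
- exact: nearW.
- by apply: nearW => k i; exact: (v_subgradient run (@always_reached k) i).
- by apply: nearW => k u; exact: (dotp_G_ge0 (@always_reached k) u).
- by apply: nearW => k; exact: (minimizer_d (@always_reached k)).
- exact: direction_cvg0.
Qed.

Let cvg_along (W : topologicalType) (u : nat -> W) (l : W) :
  u @ \oo --> l -> u @ F --> l.
Proof. by move=> ul A /ul; exact: F_oo. Qed.

(** As [d k] tends to 0, the linearized infeasibility tends to the constraint violation at [xbar],
    yet it is eventually below [c |d k|], which tends to 0. *)
Lemma bounded_penalty_feasible : bounded_fun p -> feasible X g h xbar.
Proof.
move=> bp.
apply/(feasible_real std Xxbar) => i.
have [] := @subgradients_cvg _ _ _ X g h std nat F x v xbar _ x_cvg _ FU.
- exact: nearW.
- by apply: nearW => k j; exact: (v_subgradient run (@always_reached k) j).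
move=> w [vw _].
have d0 := direction_cvg0.
have infeas : infeasibility_real g h (x k) (v k) (d k) @[k --> F] -->
    \sum_i Num.max (phi_real g h (Some i) xbar) 0.
  apply: cvg_sumr => j; apply: cvg_max0.
  rewrite -[X in _ --> X]addr0 -(dotp0r (gradient (g (Some j)) xbar - w (Some j))).
  by apply: (cvg_linearization_real std _ x_cvg (vw _) d0); exact: nearW.
have cd0 : c * (n.+1%:R * `|d k|) @[k --> F] --> (0 : R).
  rewrite -(mulr0 c) -(mulr0 n.+1%:R) -(@normr0 _ 'rV[R]_n).
  by do 2 apply: cvgMr; exact: cvg_norm.
have le0 : \forall k \near F,
    0 <= c * (n.+1%:R * `|d k|) - infeasibility_real g h (x k) (v k) (d k).
  apply: filterS (F_oo (bounded_penalty_infeasibility bp)) => k H.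
  rewrite subr_ge0; apply: le_trans (ltW H) _.
  by rewrite ler_pM2l ?(c_gt0 run)// enorm_le_norm.
have sum0 : \sum_i Num.max (phi_real g h (Some i) xbar) 0 <= 0.
  by rewrite -oppr_ge0 -sub0r; exact: cvgr_to_ge (cvgB cd0 infeas) le0.
apply: le_trans sum0; rewrite (bigD1 i)//= ler_wpDr//.
  by apply: sumr_ge0 => j _; rewrite le_max lexx orbT.
by rewrite le_max lexx.
Qed.

Lemma bounded_penalty_stationary :
  bounded_fun p -> stationary_point X g h xbar.
Proof.
move=> bp.
apply: (stationary_of_multiplier_condition std (bounded_penalty_inv_lim bp)).
  exact: bounded_penalty_feasible.
apply: limit_multiplier_condition.
exact: cvg_along penalty_inv_cvg.
Qed.

Lemma unbounded_penalty_violation_stationary :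
  ~ bounded_fun p -> violation_stationary_point X g h xbar.
Proof.
move=> ub; apply: (violation_of_multiplier_condition std).
apply: limit_multiplier_condition.
exact: cvg_along (unbounded_penalty_inv_cvg0 ub).
Qed.

End Run.

Theorem theorem3p9 (R : realType) (n : nat) (I : finType)
    (X : set 'rV[R]_n) (g : option I -> 'rV[R]_n -> R)
    (h : option I -> 'rV[R]_n -> \bar R)
    (alpha MG beta sigma rho c : R) (x0 : 'rV[R]_n) (p0 : R)
    (x : nat -> 'rV[R]_n) (p : nat -> R)
    (v : nat -> option I -> 'rV[R]_n) (G : nat -> 'M[R]_n)
    (d : nat -> 'rV[R]_n) (q : nat -> nat) :
  standing_assumptions X g h ->
  cdp_esqm_run X g h alpha MG beta sigma rho c x0 p0 x p v G d q ->
  (exists k, terminates_at g h x d k /\ stationary_point X g h (x k)) \/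
  [/\ forall k, ~ stop g h x d k,
      forall (kj : nat -> nat) (xbar : 'rV[R]_n),
        increasing_seq kj -> (x \o kj) @ \oo --> xbar ->
        (bounded_fun p -> stationary_point X g h xbar) /\
        (~ bounded_fun p -> violation_stationary_point X g h xbar),
      bounded_fun x ->
        [/\ cluster (x @ \oo) !=set0, closed (cluster (x @ \oo))
          & connected (cluster (x @ \oo))] &
      forall xbar : 'rV[R]_n,
        isolated (cluster (x @ \oo)) xbar -> x @ \oo --> xbar].
Proof.
Proof.
move=> std run.
have [[k0 stop0]|nostop0] := pselect (exists k, stop g h x d k).
  left; pose P k := `[< stop g h x d k >].
  have exP : exists k, P k by exists k0; exact/asboolP.
  have [k /asboolP stopk kmin] := ex_minnP exP.
  have reachk : reached g h x d k.
    by move=> j jk /asboolP/kmin; rewrite leqNgt jk.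
  by exists k; split; [split|exact: (stop_stationary std run reachk stopk)].
have nostop k : ~ stop g h x d k by move=> s; apply: nostop0; exists k.
have step0 := step_cvg0 std run nostop.
right; split=> //.
- move=> kj xbar kj_incr xkj.
  (* The ultrafilter refines the image of [\oo] under [kj], so it lives on iteration indices; since
     [kj k >= k], it also refines [\oo]. *)
  have [F [FU kjF]] := @ultraFilterLemma nat (kj @ \oo) _.
  have F_oo : \oo `<=` F.
    move=> A [N _ NA]; apply: kjF; exists N => // k /= Nk; apply: NA.
    exact: leq_trans Nk (unstable.mono_leq_infl kj_incr k).
  have x_cvg : x @ F --> xbar by move=> A /xkj; exact: kjF.
  split; first exact: (bounded_penalty_stationary std run nostop FU F_oo x_cvg).
  exact: (unbounded_penalty_violation_stationary std run nostop FU F_oo x_cvg).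
- exact: bounded_cluster_set.
- exact: isolated_cluster_cvg.
Qed.
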